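(* Consider all lattices $\Lambda\subset\mathbb{R}^2$ up to NBA equivalence, and their normalized dispersions $\mathrm{disp}(\Lambda)/\det(\Lambda)\in(0,\infty]$. Let $\varphi=\frac{1+\sqrt5}{2}$ and $\overline\varphi=1-\varphi$. (1) The lattice with the smallest normalized dispersion is the lattice $\Lambda_5$ generated by (the columns of) $\begin{pmatrix}1&\varphi\\1&\overline\varphi\end{pmatrix}$, and $\dfrac{\mathrm{disp}(\Lambda_5)}{\det(\Lambda_5)}=\dfrac{\varphi^3}{\sqrt5}$. (2) The lattice with the second smallest normalized dispersion is the lattice $\Lambda_2$ generated by $\begin{pmatrix}1&1+\sqrt2\\1&1-\sqrt2\end{pmatrix}$, and $\dfrac{\mathrm{disp}(\Lambda_2)}{\det(\Lambda_2)}=\dfrac{3+2\sqrt2}{2\sqrt2}$. (3) For every $n\ge1$, the lattice with the $(n+2)$-th smallest normalized dispersion is generated by $\begin{pmatrix}1&-\Delta\\1&-\overline\Delta\end{pmatrix}$ with $\Delta=[\overline{2,\underbrace{1,\dots,1}_{2n},2}]$, where $\overline\Delta$ is the algebraic conjugate of the quadratic irrational $\Delta$. (4) The sequence whose $n$-th term is the $n$-th smallest normalized dispersion converges to $\frac{4+\sqrt5}{3}$, which is the normalized dispersion of the lattice generated by $\begin{pmatrix}1&-\Delta\\1&-\widetilde\Delta\end{pmatrix}$ with $\Delta=[2,\overline1]=\varphi^2$ and $-\widetilde\Delta=[0,2,\overline1]=\varphi^{-2}$. Here ''the lattice with the $k$-th smallest normalized dispersion'' means that the set of values of the normalized dispersion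 has a $k$-th smallest element and that it is attained exactly by the given lattice, up to NBA equivalence.
   Context: A lattice in $\mathbb{R}^2$ is $A\mathbb{Z}^2$ for an invertible real $2\times 2$ matrix $A$, and $\det(\Lambda)=|\det A|$. The dispersion $\mathrm{disp}(\Lambda)$ is the supremum of the areas of all open axis-parallel boxes in $\mathbb{R}^2$ containing no point of $\Lambda$. Square brackets denote continued fractions and an overline inside brackets denotes a repeated period. Two invertible real $2\times2$ matrices are NBA (normalized box area) equivalent if one is obtained from the other by a finite sequence of the operations: multiplication from the left by a diagonal matrix $\mathrm{diag}(a,b)$ with $ab\ne0$; multiplication from the left by $\begin{pmatrix}0&1\\1&0\end{pmatrix}$; multiplication from the right by a matrix in $\mathrm{GL}_2(\mathbb{Z})$. Two lattices are NBA equivalent if they have NBA equivalent generating matrices; NBA equivalent lattices have the same normalized dispersion. *)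

(* Defs.v *)
From HB Require Import structures.
From mathcomp Require Import all_boot all_order all_algebra.
From mathcomp Require Import all_classical all_reals all_analysis.
Set Implicit Arguments.
Unset Strict Implicit.
Unset Printing Implicit Defensive.
Import Order.TTheory GRing.Theory Num.Theory.
Import numFieldNormedType.Exports.
Local Open Scope classical_set_scope.
Local Open Scope card_scope.
Local Open Scope ring_scope.

Definition mx22 {T : Type} (a b c d : T) : 'M[T]_2 :=
  \matrix_(i < 2, j < 2)
    if i == 0 then (if j == 0 then a else b) else (if j == 0 then c else d).

Section Lattices.
Context {R : realType}.
Implicit Types (A B : 'M[R]_2) (L : set 'cV[R]_2).

Definition lattice_of A : set 'cV[R]_2 :=
  [set A *m map_mx intr z | z in [set: 'cV[int]_2]].

Definition is_lattice L : Prop :=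
  exists2 A, A \in unitmx & L = lattice_of A.

(* Some generating matrix of [L]; by [lattice_det_of] below, the choice does
   not affect [lattice_det]. *)
Definition lattice_basis L : 'M[R]_2 :=
  xget 0 [set A | A \in unitmx /\ L = lattice_of A].

Definition lattice_det L : R := `|\det (lattice_basis L)|.

Lemma lattice_of_sub A B : lattice_of A `<=` lattice_of B ->
  exists M : 'M[int]_2, A = B *m map_mx intr M.
Proof.
move=> sAB.
have h (j : 'I_2) : exists z : 'cV[int]_2, B *m map_mx intr z = col j A.
  have : lattice_of A (col j A).
    exists (delta_mx j 0) => //.
    by rewrite map_delta_mx colE.
  by case/sAB => z _ <-; exists z.
have [f hf] := choice h.
exists (\matrix_(i, j) f j i 0); apply/matrixP => i j.
transitivity (col j A i 0); first by rewrite mxE.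
rewrite -hf !mxE; apply: eq_bigr => k _.
by rewrite !mxE.
Qed.

Lemma lattice_det_of A : A \in unitmx -> lattice_det (lattice_of A) = `|\det A|.
Proof.
move=> uA; rewrite /lattice_det /lattice_basis; case: xgetP; last first.
  by move=> /(_ A) [].
move=> B _ [uB eAB].
have [M eM] : exists M : 'M[int]_2, A = B *m map_mx intr M.
  by apply: lattice_of_sub; rewrite eAB.
have [N eN] : exists N : 'M[int]_2, B = A *m map_mx intr N.
  by apply: lattice_of_sub; rewrite eAB.
have dA : `|\det A| = `|\det B| * `|\det M|%:~R.
  by rewrite {1}eM det_mulmx det_map_mx normrM intr_norm.
have dB : `|\det B| = `|\det A| * `|\det N|%:~R.
  by rewrite {1}eN det_mulmx det_map_mx normrM intr_norm.
have A0 : 0 < `|\det A| by rewrite normr_gt0 -unitfE -unitmxE.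
have B0 : 0 < `|\det B| by rewrite normr_gt0 -unitfE -unitmxE.
have ge1 (k : int) x y : 0 < x -> 0 < y -> x = y * `|k|%:~R :> R -> y <= x.
  move=> x0 y0 e; rewrite e ler_pMr // -[1]/(1%:~R) ler_int.
  rewrite -gtz0_ge1 normr_gt0; apply: contraTneq x0 => k0.
  by rewrite e k0 normr0 mulr0 ltxx.
by apply/eqP; rewrite eq_le (ge1 _ _ _ A0 B0 dA) (ge1 _ _ _ B0 A0 dB).
Qed.

Definition open_box (a b c d : R) : set 'cV[R]_2 :=
  [set v | a < v 0 0 < b /\ c < v 1 0 < d].

Definition disp L : \bar R :=
  ereal_sup [set s | exists a b c d : R,
    [/\ a < b, c < d, open_box a b c d `&` L = set0
      & s = ((b - a) * (d - c))%:E]].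

Definition ndisp L : \bar R := (disp L * (lattice_det L)^-1%:E)%E.

Inductive nba_mx A : 'M[R]_2 -> Prop :=
| nba_refl : nba_mx A A
| nba_diag (a b : R) B :
    a * b != 0 -> nba_mx A B -> nba_mx A (mx22 a 0 0 b *m B)
| nba_swap B : nba_mx A B -> nba_mx A (mx22 0 1 1 0 *m B)
| nba_unimodular (U : 'M[int]_2) B :
    U \in unitmx -> nba_mx A B -> nba_mx A (B *m map_mx intr U).

Definition nba_equiv L L' : Prop :=
  exists A B, [/\ A \in unitmx, B \in unitmx, L = lattice_of A,
                  L' = lattice_of B & nba_mx A B].

Definition ndisp_values : set (\bar R) := ndisp @` is_lattice.

(* For k >= 1: x belongs to S and exactly k elements of S, x itself included,
   are at most x. *)
Definition kth_smallest (S : set (\bar R)) (k : nat) (x : \bar R) : Prop :=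
  S x /\ [set y | S y /\ (y <= x)%E] #= `I_k.

Definition kth_lattice (k : nat) L : Prop :=
  [/\ is_lattice L, kth_smallest ndisp_values k (ndisp L)
    & forall L', is_lattice L' -> (ndisp L' = ndisp L <-> nba_equiv L L')].

Fixpoint convergent (a : nat -> nat) (n : nat) : R :=
  if n is m.+1 then (a 0%N)%:R + (convergent (fun k => a k.+1) m)^-1
  else (a 0%N)%:R.

(* The infinite continued fraction [u, w, w, w, ...]; w must be nonempty. *)
Definition cfrac (u w : seq nat) : R :=
  let a k := if (k < size u)%N then nth 0%N u k
             else nth 0%N w ((k - size u) %% size w) in
  lim (convergent a n @[n --> \oo]).

(* x is a quadratic irrational and y is its algebraic conjugate: they are the
   two roots of an irreducible rational quadratic. *)
Definition quadratic_conjugate (x y : R) : Prop :=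
  exists p : {poly rat}, [/\ irreducible_poly p, size p = 3%N &
    map_poly ratr p
      = ratr (lead_coef p) *: (('X - x%:P) * ('X - y%:P)) :> {poly R}].

Definition golden : R := (1 + Num.sqrt 5) / 2.

End Lattices.

(* Main.v *)
Require Import Defs.
From HB Require Import structures.
From mathcomp Require Import all_boot all_order all_algebra.
From mathcomp Require Import all_classical all_reals all_analysis.
From mathcomp Require Import ring lra zify.
Import Order.TTheory GRing.Theory Num.Theory.
Import numFieldNormedType.Exports.
Local Open Scope classical_set_scope.
Local Open Scope ring_scope.

(** Replacing a lattice by an NBA equivalent one, it may be given by slopes
    [a, b > 0]: its points are [(m + n * a, m - n * b)], and its basis vectors
    [(1, 1)] and [(a, - b)] point to different sides of the horizontal axis.
    The box spanned by the parallelogram on such a basis is empty and has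
    normalized area [1 + (1 + a * b) / (a + b)] ([ndisp_slope_ge]); conversely
    every empty box is at most as large as one of these boxes
    ([ndisp_slope_le]).  The bases of this kind form a chain, in which a vector
    is replaced by the sum of both; on slopes this means the moves
    [(a, b) -> (a - 1, b + 1)] and [(a, b) -> (a^-1, b^-1)], up to exchanging
    the coordinates.  Hence the chain is encoded by a two-sided sequence of
    partial quotients, and the normalized dispersion minus 1 is the supremum of
    [(1 + a * b) / (a + b)] over all pairs obtained by cutting this sequence,
    possibly in the interior of a partial quotient.  A lattice with a point on
    an axis has infinite dispersion, and every other lattice has such a chain
    ([slope_or_infiniteP]).

    It remains to find the sequences with supremum below
    [2 * golden / 3 = (1 + sqrt 5) / 3] ([slope_classification]).  A partial
    quotient 3 or more always leads to too large a value, and otherwise only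
    cuts in the middle of a 2 give values above 1.  If only 1 occurs, the
    slope is [golden].  Otherwise the value at a 2 decreases as the expansions
    read off on both sides of it increase.  This forbids an isolated 2 and a 2
    between 1 and 2,2, so, unless all digits are 2, the 2s come in blocks 2,2
    separated by runs of 1s.  Let [s] and [t] be the expansions read off on the
    two sides of such a block.  Smallness of the two values at the block forces
    [s] and [t] to exceed [golden], so that both runs are finite and of even
    length; and if one run were longer than the other, its side would be so
    much closer to [golden] that the value at the block would be too large.
    Therefore all runs have the same length [2 * n], and the sequence is
    periodic.

    The slopes of the extremal lattices are [d] and [d^-1], where [d] is the
    positive root of [X ^+ 2 - b * X - 1].  The value is then
    [1 + (b + 1) / sqrt (b ^+ 2 + 4)], increasing in [b], with [b = 1] for
    [golden] and a quotient [slope_trace n] of Fibonacci expressions,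
    increasing to [sqrt 5], for the period with run length [2 * n]; the case
    [n = 0] is the lattice of [1 + sqrt 2]. *)

Set Implicit Arguments.
Unset Strict Implicit.
Unset Printing Implicit Defensive.

(** * The golden ratio and expanding maps *)

Section GoldenRatio.
Context {R : realType}.
Local Notation phi := (@golden R).

Lemma golden_sqr : phi * phi = phi + 1.
Proof.
have h : Num.sqrt 5 * Num.sqrt 5 = 5 :> R by rewrite -expr2 sqr_sqrtr.
rewrite /golden; lra.
Qed.

Lemma golden_lb : 55 / 34 < phi.
Proof.
have h := golden_sqr.
have h0 : 0 <= phi.
  by rewrite /golden divr_ge0 // addr_ge0 // sqrtr_ge0.
nra.
Qed.

Lemma golden_ub : phi < 34 / 21.
Proof.
have h := golden_sqr; have := golden_lb; nra.
Qed.

Lemma sqrt5E : Num.sqrt 5 = 2 * phi - 1 :> R.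
Proof. rewrite /golden; lra. Qed.

Lemma golden_inv : phi^-1 = phi - 1.
Proof.
have h := golden_sqr; have h1 := golden_lb.
have phi0 : phi != 0 by apply/eqP; lra.
by apply: (mulfI phi0); rewrite divff //; lra.
Qed.

End GoldenRatio.

Section Expansion.
Context {R : realType}.

(** Otherwise the distance to [c] would grow beyond [M] along a sequence of
    successive choices.  This is how the fact that an expansion never ends
    determines the number that it expands. *)
Lemma expanding_bounded (P : R -> Prop) (c M : R) :
  (forall x, P x -> `|x - c| <= M) ->
  (forall x, P x -> exists2 x', P x' & 3 / 2 * `|x - c| <= `|x' - c|) ->
  forall x, P x -> x = c.
Proof.
move=> bP eP.
have grow (n : nat) : forall x, P x ->
    exists2 x', P x' & (1 + n%:R / 2) * `|x - c| <= `|x' - c|.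
  elim: n => [|n IH] x Px; first by exists x => //; rewrite mul0r addr0 mul1r.
  have [x1 Px1 le1] := eP x Px; have [x2 Px2 le2] := IH _ Px1.
  exists x2 => //; apply: le_trans le2.
  have n0 : 0 <= n%:R :> R by [].
  rewrite -natr1; have := normr_ge0 (x - c); nra.
move=> x Px; apply/eqP; rewrite -subr_eq0 -normr_le0 leNgt; apply/negP => d0.
pose n := (Num.truncn (2 * M / `|x - c|)).+1.
have [x' Px' le'] := grow n x Px; have := bP _ Px'.
have : 2 * M / `|x - c| < n%:R by exact: truncnS_gt.
rewrite ltr_pdivrMr //; nra.
Qed.

End Expansion.

(** * Systems of slopes and partial quotients *)

Section SlopeSystems.
Context {R : realType}.
Implicit Types (G : R -> R -> Prop) (a b x y s t : R).

(** The symmetries of the set of slopes of all bases of one lattice that has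
    no point on an axis.  They suffice both to run the continued fraction
    algorithm and to walk along all bases. *)
Record slope_system G : Prop := SlopeSystem {
  slope_gt0 : forall a b, G a b -> 0 < a /\ 0 < b;
  slope_neq1 : forall a b, G a b -> a != 1;
  slope_sym : forall a b, G a b -> G b a;
  slope_inv : forall a b, G a b -> G a^-1 b^-1;
  slope_sub : forall a b, G a b -> 1 < a -> G (a - 1) (b + 1) }.

Definition cf1 x : R := 1 + x^-1.
Definition cf2 x : R := 2 + x^-1.
(** Two partial quotients 1, as one homographic map: see [cf1_cf1]. *)
Definition cf11 x : R := (2 * x + 1) / (x + 1).

Lemma cf1K x : 1 < x -> cf1 (x - 1)^-1 = x.
Proof. by move=> x1; rewrite /cf1 invrK; lra. Qed.

Lemma cf2K x : 2 < x -> cf2 (x - 2)^-1 = x.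
Proof. by move=> x2; rewrite /cf2 invrK; lra. Qed.

Lemma cf1_bounds x : 1 < x -> 1 < cf1 x < 2.
Proof.
move=> x1; have : 0 < x^-1 < 1 by rewrite invr_gt0 invf_lt1; lra.
by rewrite /cf1; lra.
Qed.

Lemma cf2_bounds x : 1 < x -> 2 < cf2 x < 3.
Proof.
move=> x1; have : 0 < x^-1 < 1 by rewrite invr_gt0 invf_lt1; lra.
by rewrite /cf2; lra.
Qed.

Lemma invf_bounds (l u x : R) : 0 < l -> l < x < u -> 1 / u < x^-1 < 1 / l.
Proof. by move=> l0 h; rewrite !div1r !ltf_pV2 ?posrE; lra. Qed.

Lemma cf22_bounds x : 1 < x < 2 -> 7 / 3 < cf2 (cf2 x) < 12 / 5.
Proof.
move=> h; have := invf_bounds ltr01 h; rewrite divr1 => h1.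
have h2 : 5 / 2 < cf2 x < 3 by rewrite /cf2; lra.
have : 1 / 3 < (cf2 x)^-1 < 2 / 5.
  by rewrite -[2 / 5]invf_div -[(5 / 2)^-1]div1r; apply: invf_bounds h2; lra.
by rewrite -[cf2 (cf2 x)]/(2 + (cf2 x)^-1); lra.
Qed.

Lemma cf1_cf1 x : 1 < x -> cf1 (cf1 x) = cf11 x.
Proof. by move=> x1; rewrite /cf1 /cf11; field; lra. Qed.

Lemma cf11_bounds x : 1 < x -> 1 < cf11 x < 2.
Proof.
by move=> x1; rewrite -cf1_cf1 //; apply: cf1_bounds; case/andP: (cf1_bounds x1).
Qed.

Lemma iter_cf1_gt1 n x : 1 < x -> 1 < iter n cf1 x.
Proof.
move=> x1; elim: n => //= n IH; by case/andP: (cf1_bounds IH).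
Qed.

Lemma iter_cf11_gt1 n x : 1 < x -> 1 < iter n cf11 x.
Proof.
move=> x1; elim: n => //= n IH; by case/andP: (cf11_bounds IH).
Qed.

Lemma iter_cf1_double n x : 1 < x -> iter n.*2 cf1 x = iter n cf11 x.
Proof.
move=> x1; elim: n => //= n ->; apply: cf1_cf1; exact: iter_cf11_gt1.
Qed.

Local Notation phi := (@golden R).

Lemma cf1_golden_lt x : phi < x -> cf1 x < phi.
Proof.
move=> h; have := @golden_lb R => g.
have -> : phi = cf1 phi by rewrite /cf1 golden_inv; lra.
by rewrite /cf1 ltrD2l ltf_pV2 ?posrE; lra.
Qed.

Lemma cf1_golden_gt x : 1 < x < phi -> phi < cf1 x.
Proof.
move=> h; have := @golden_lb R => g.
have -> : phi = cf1 phi by rewrite /cf1 golden_inv; lra.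
by rewrite /cf1 ltrD2l ltf_pV2 ?posrE; lra.
Qed.

Lemma cf11_golden_gt x : phi < x -> phi < cf11 x.
Proof.
move=> h; have := @golden_lb R => g; have x1 : 1 < x by lra.
rewrite -cf1_cf1 //; apply: cf1_golden_gt; rewrite cf1_golden_lt // andbT.
by case/andP: (cf1_bounds x1).
Qed.

Lemma iter_cf11_golden_gt n x : phi < x -> phi < iter n cf11 x.
Proof. by move=> h; elim: n => //= n IH; exact: cf11_golden_gt. Qed.

(** [phi] is the attracting fixed point of [cf1]. *)
Lemma cf1_contract x : 1 < x -> 3 / 2 * `|cf1 x - phi| <= `|x - phi|.
Proof.
move=> x1; have := @golden_lb R; have := @golden_inv R => g1 g2.
have -> : cf1 x - phi = - ((phi - 1) / x) * (x - phi).
  have e : phi = 1 + phi^-1 by lra.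
  by rewrite -g1 {1}e /cf1; field; lra.
rewrite normrM normrN (ger0_norm (_ : 0 <= (phi - 1) / x)); last first.
  by apply: divr_ge0; lra.
have : (phi - 1) / x <= 2 / 3 by have := @golden_ub R; rewrite ler_pdivrMr; lra.
have := normr_ge0 (x - phi); nra.
Qed.
End SlopeSystems.

(** * Cuts of an expansion of small value *)

Section Cuts.
Context {R : realType}.
Local Notation phi := (@golden R).
Implicit Types a b x y s t X Y : R.

Variable G : R -> R -> Prop.
Hypothesis sysG : slope_system G.
Hypothesis small : forall a b, G a b -> 3 * (1 + a * b) < 2 * phi * (a + b).

(** [X] and [Y] are the expansions read to the right and to the left from a
    point between two partial quotients. *)
Definition cut X Y := [/\ 1 < X, 1 < Y & G X Y^-1].

Lemma cut_sym X Y : cut X Y -> cut Y X.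
Proof.
case=> X1 Y1 /(slope_sym sysG) /(slope_inv sysG); rewrite invrK => h.
by split.
Qed.

Lemma cut_step1 X Y : cut X Y -> X < 2 ->
  exists2 x, X = cf1 x & cut x (cf1 Y).
Proof.
case=> X1 Y1 GXY X2; exists (X - 1)^-1; first by rewrite cf1K.
split; first by rewrite invf_gt1; lra.
  by case/andP: (cf1_bounds Y1).
by have := slope_inv sysG (slope_sub sysG GXY X1); rewrite [Y^-1 + 1]addrC.
Qed.

Lemma cut_neq2 X Y : cut X Y -> X != 2.
Proof.
case=> X1 _ /(slope_sub sysG) /(_ X1) /(slope_neq1 sysG) /eqP h.
by apply/eqP => e; apply: h; rewrite e; lra.
Qed.

Lemma cut_case X Y : cut X Y -> X < 2 \/ 2 < X.
Proof. by move=> /cut_neq2; case: ltgtP => // h _; [left|right]. Qed.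

Lemma cut_lt4 X Y : cut X Y -> X < 4.
Proof.
case=> X1 Y1 GXY; rewrite ltNge; apply/negP => X4.
have /small := slope_sub sysG (slope_sub sysG GXY X1) (ltac:(lra)).
have : 0 < Y^-1 by rewrite invr_gt0; lra.
set y := Y^-1 => y0; have := @golden_ub R; have := @golden_lb R.
nra.
Qed.

(** A partial quotient 3 contributes the slopes [(X - 1, Y^-1 + 1)] and
    [(X - 2, Y^-1 + 2)].  Smallness of both needs small fractional parts on
    both sides, that is, neighbours which are themselves at least 3; applied to
    a neighbour this becomes contradictory. *)
Lemma cut_ge3 X Y : cut X Y -> 3 <= X -> X < 33 / 10 /\ 33 / 10 < Y.
Proof.
case=> X1 Y1 GXY X3; have X4 : X < 4 by apply: (@cut_lt4 _ Y).
have G1 := slope_sub sysG GXY X1.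
have G2 := slope_sub sysG G1 (ltac:(lra)).
have y0 : 0 < Y^-1 < 1 by rewrite invr_gt0 invf_lt1; lra.
have := small G1; have := small G2.
have eY : Y * Y^-1 = 1 by rewrite divff //; lra.
set y := Y^-1 in y0 eY *.
have := @golden_ub R; have := @golden_lb R => g1 g2 h2 h1.
have yb : y < 29 / 100.
  rewrite ltNge; apply/negP => y1; nra.
split; last by nra.
rewrite ltNge; apply/negP => x1; nra.
Qed.

Lemma cut_lt3 X Y : cut X Y -> X < 3.
Proof.
move=> c; rewrite ltNge; apply/negP => /(cut_ge3 c) [X1 Y1].
by have [] := cut_ge3 (cut_sym c) (ltac:(lra)); lra.
Qed.

Lemma cut_cf2 x Y : cut (cf2 x) Y -> 1 < x -> cut x (cf2 Y).
Proof.
case=> X1 Y1 GXY x1; split => //; first by have := cf2_bounds Y1; lra.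
have G1 := slope_sub sysG GXY X1.
have G2 := slope_sub sysG G1 (ltac:(have := cf2_bounds x1; lra)).
have := slope_inv sysG G2; congr G; last by rewrite /cf2; congr (_^-1); lra.
by rewrite /cf2 -[RHS]invrK; congr (_^-1); lra.
Qed.

Lemma cut_step2 X Y : cut X Y -> 2 < X ->
  exists x, [/\ X = cf2 x, 1 < x & cut x (cf2 Y)].
Proof.
move=> c X2; have X3 := cut_lt3 c; have x1 : 1 < (X - 2)^-1.
  by rewrite invf_gt1; lra.
exists (X - 2)^-1; split=> //; first by rewrite cf2K.
by apply: cut_cf2 => //; rewrite cf2K.
Qed.

(** The value at the middle of a 2, in terms of the expansions [x] and [Y]
    on its two sides; [6 * phi + 3] is the value of the right-hand side at
    [x = phi] and [Y = phi ^+ 2]. *)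
Lemma cut_bound x Y : cut (cf2 x) Y -> 1 < x ->
  6 * phi + 3 < 2 * x * Y + x + Y.
Proof.
case=> X1 Y1 GXY x1; have := small (slope_sub sysG GXY X1).
have xY0 : 0 < x * Y by rewrite mulr_gt0; lra.
rewrite -(ltr_pM2r xY0).
rewrite (_ : _ * (x * Y) = 3 * (2 * x * Y + x + Y + 1)); last first.
  by rewrite /cf2; field; lra.
rewrite [X in _ < X -> _](_ : _ = 2 * phi * (2 * x * Y + x + Y)); last first.
  by rewrite /cf2; field; lra.
set W := 2 * x * Y + x + Y => h.
have := @golden_sqr R; have := @golden_lb R; nra.
Qed.

(** Removing a digit 1 expands distances to [phi]. *)
Lemma cut_golden : (forall X Y, cut X Y -> X < 2) ->
  forall X Y, cut X Y -> X = phi.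
Proof.
move=> all1 X Y cXY.
apply: (@expanding_bounded R (fun X => exists Y, cut X Y) phi 2); last by exists Y.
  move=> {cXY} {}X [{}Y cXY]; have X2 := all1 _ _ cXY; case: cXY => X1 _ _.
  by have := @golden_lb R; have := @golden_ub R; rewrite ler_norml; lra.
move=> {cXY} {}X [{}Y cXY]; have [x -> cx] := cut_step1 cXY (all1 _ _ cXY).
exists x; first by exists (cf1 Y).
by apply: cf1_contract; case: cx.
Qed.

Lemma cf2_contract c x : 1 < x -> 2 < c -> cf2 c = c ->
  3 / 2 * `|cf2 x - c| <= `|x - c|.
Proof.
move=> x1 c2 e; rewrite -{1}e.
have -> : cf2 x - cf2 c = - (x * c)^-1 * (x - c) by rewrite /cf2; field; lra.
rewrite normrM normrN (ger0_norm (_ : 0 <= (x * c)^-1)); last first.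
  by rewrite invr_ge0; nra.
have : (x * c)^-1 <= 2 / 3.
  rewrite -[2 / 3]invf_div lef_pV2 ?posrE ?mulr_gt0 //; try lra.
  by nra.
by have := normr_ge0 (x - c); nra.
Qed.

(** If 2 is never adjacent to 1, then every digit after a 2 is 2, and
    removing a digit 2 expands distances to the fixed point [c] of [cf2]. *)
Lemma cut_silver c : 2 < c -> cf2 c = c ->
  (forall X Y, cut X Y -> 2 < X -> 2 < Y) ->
  forall X Y, cut X Y -> 2 < X -> X = c.
Proof.
move=> c2 ec all2 X Y cXY X2.
apply: (@expanding_bounded R (fun X => 2 < X /\ exists Y, cut X Y) c 3).
- move=> {X2 cXY} {}X [X2 [{}Y cXY]]; have X3 := cut_lt3 cXY.
  have : c < 3 by rewrite -ec; have := @cf2_bounds R c; lra.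
  by rewrite ler_norml; lra.
- move=> {X2 cXY} {}X [X2 [{}Y cXY]]; have [x [-> x1 cx]] := cut_step2 cXY X2.
  exists x; last exact: cf2_contract.
  split; last by exists (cf2 Y).
  apply: all2 (cut_sym cx) _.
  by case: cXY => _ Y1 _; case/andP: (cf2_bounds Y1).
- by split => //; exists Y.
Qed.

(** A block 2,2 seen from its middle, with the digit 1 on both sides: [s]
    and [t] are the expansions read to the left and to the right from it. *)
Definition twin s t := [/\ 1 < s < 2, 1 < t < 2 & cut (cf2 t) (cf2 s)].

Lemma twin_sym s t : twin s t -> twin t s.
Proof. by case=> hs ht /cut_sym. Qed.

Lemma twin_bound s t : twin s t ->
  (6 * phi + 3) * s < 5 * t * s + 2 * t + 2 * s + 1.
Proof.
case=> hs ht /cut_bound; have := invf_bounds ltr01 hs; rewrite divr1 /cf2 => h.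
have es : s * s^-1 = 1 by rewrite divff //; lra.
move=> /(_ ltac:(lra)); set s' := s^-1 in h es *.
nra.
Qed.

(** Each of the two values at the block bounds one of [s] and [t] from below
    by an increasing function of the other one.  So the smaller one satisfies the
    bound for [s = t], which is [phi]. *)
Lemma twin_golden s t : twin s t -> phi < s.
Proof.
move=> tw; have b1 := twin_bound tw; have b2 := twin_bound (twin_sym tw).
case: tw => hs ht _; have g := @golden_sqr R; have g1 := @golden_lb R.
have g2 := @golden_ub R.
rewrite ltNge; apply/negP => sphi.
have [ts|st] := leP t s; first by nra.
have [tp|pt] := leP t phi; nra.
Qed.
End Cuts.

(** * Classification of the expansions of small value *)

Section Classification.
Context {R : realType}.
Local Notation phi := (@golden R).
Implicit Types a b x y s t X Y : R.

Variable G : R -> R -> Prop.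
Hypothesis sysG : slope_system G.
Hypothesis small : forall a b, G a b -> 3 * (1 + a * b) < 2 * phi * (a + b).

Local Notation cut := (cut G).
Local Notation twin := (twin G).

(** A 2 whose left neighbour is 1 has right neighbour 2, followed by 1: an
    isolated 2 has [x, Y < 2], and 1,2,2,2 has [x < 17/7] and [Y < 7/4], which
    both contradict [cut_bound]. *)
Lemma cut_twin X Y : cut X Y -> 2 < X -> Y < 2 ->
  exists2 t, X = cf2 (cf2 t) & twin Y t.
Proof.
move=> c X2 Y2; have [_ Y1 _] := c.
have g1 := @golden_lb R.
have [x [eX x1 cx]] := cut_step2 sysG small c X2; rewrite {}eX in c X2 *.
have bx := cut_bound sysG small c x1.
have [x2|x2] := cut_case sysG cx; first by nra.
have [y [ex y1 cy]] := cut_step2 sysG small cx x2; rewrite {}ex in c X2 cx x1 x2 bx *.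
exists y => //; split; [lra| |exact: cx].
rewrite y1 /=; have [//|y2] := cut_case sysG cy; exfalso.
have [z [ey z1 cz]] := cut_step2 sysG small cy y2.
have z3 := cut_lt3 sysG small cz.
(* The digits around the cut are 1, 2, 2, 2. *)
have y7 : 7 / 3 < y.
  have : 1 / 3 < z^-1 < 1 / 1 by apply: invf_bounds; lra.
  by rewrite ey /cf2; lra.
have y3 := cut_lt3 sysG small cy.
have x17 : cf2 y < 17 / 7.
  have : 1 / 3 < y^-1 < 3 / 7; last by rewrite /cf2; lra.
  by rewrite -[3 / 7]invf_div -[(7 / 3)^-1]div1r; apply: invf_bounds; lra.
have [u eY cu] := cut_step1 sysG (cut_sym sysG c) Y2.
have u43 : 4 / 3 < u.
  have [u2|] := cut_case sysG cu; last by lra.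
  have [v -> cv] := cut_step1 sysG cu u2; have v3 := cut_lt3 sysG small cv.
  have [v1 _ _] := cv.
  have : 1 / 3 < v^-1 < 1 / 1 by apply: invf_bounds; lra.
  by rewrite /cf1; lra.
have Y74 : Y < 7 / 4.
  have : 1 / (u + 1) < u^-1 < 3 / 4; last by rewrite eY /cf1; lra.
  by rewrite -[3 / 4]invf_div -[(4 / 3)^-1]div1r; apply: invf_bounds; lra.
nra.
Qed.

(** A run of 1s to the right of the cut ends, since the removal of its
    digits expands the distance of [X] to [phi]. *)
Lemma cut_run X Y : cut X Y -> X < 2 -> X != phi ->
  exists j x, [/\ X = iter j.+1 cf1 x, 2 < x & cut x (iter j.+1 cf1 Y)].
Proof.
move=> c X2 Xphi.
have d0 : 0 < `|X - phi| by rewrite normr_gt0 subr_eq0.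
have [n] : exists n : nat, 1 <= (1 + n%:R / 2) * `|X - phi|.
  exists (Num.truncn (2 / `|X - phi|)).+1.
  have : 2 / `|X - phi| < (Num.truncn (2 / `|X - phi|)).+1%:R by exact: truncnS_gt.
  by rewrite ltr_pdivrMr //; lra.
elim: n X Y c X2 {Xphi d0} => [|n IH] X Y c X2 le1.
  move: le1; rewrite mul0r addr0 mul1r; case: c => X1 _ _.
  by have := @golden_lb R; have := @golden_ub R; rewrite ler_normr; lra.
have [x eX cx] := cut_step1 sysG c X2.
have [x2|x2] := cut_case sysG cx; last by exists 0%N, x.
have [x1 _ _] := cx.
have [j [z [ex z2 cz]]] : exists j z,
    [/\ x = iter j.+1 cf1 z, 2 < z & cut z (iter j.+1 cf1 (cf1 Y))].
  apply: (IH _ _ cx x2); apply: le_trans le1 _.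
  have := cf1_contract x1; rewrite -eX -natr1.
  have n0 : 0 <= n%:R :> R by [].
  by have := normr_ge0 (X - phi); nra.
by exists j.+1, z; split => //; [rewrite eX ex|rewrite iterSr].
Qed.

(** The run of 1s to the right of a block 2,2 leads to another such block.
    Its length is even: the expansion read back from the next block
    exceeds [phi], and [cf1] exchanges the two sides of [phi]. *)
Lemma twin_run s t : twin s t -> exists n t',
  t = iter n cf11 (cf2 (cf2 t')) /\ twin (iter n cf11 (cf2 (cf2 s))) t'.
Proof.
move=> tw; have tphi := twin_golden sysG small (twin_sym sysG tw).
have [hs ht c] := tw.
have c1 : cut t (cf2 (cf2 s)) by apply: (cut_cf2 sysG c); lra.
have tn : t != phi by rewrite gt_eqF.
have [j [x [et x2 cx]]] := cut_run c1 (ltac:(lra)) tn.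
have zs1 : 1 < cf2 (cf2 s) by have := cf22_bounds hs; lra.
have zsphi : phi < cf2 (cf2 s).
  by have := cf22_bounds hs; have := @golden_ub R; lra.
have /cf1_bounds/andP[_ y2] := iter_cf1_gt1 j zs1.
have [t' ex tw'] := cut_twin cx x2 y2.
have zt1 : 1 < cf2 (cf2 t').
  by case: tw' => _ /cf22_bounds h _; lra.
have yphi := twin_golden sysG small tw'.
have e : j.+1 = (odd j.+1 + (j.+1)./2.*2)%N by rewrite odd_double_half.
rewrite ex in et; move: (odd _) (_./2) e => [] k e; last first.
  by exists k, t'; rewrite -!iter_cf1_double // -[k.*2]/(0 + k.*2)%N -e.
exfalso; move: yphi; rewrite e add1n iterS iter_cf1_double //.
by apply/negP; rewrite -leNgt ltW // cf1_golden_lt // iter_cf11_golden_gt.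
Qed.

(** In the coordinate [(x - phi) / (x + phi^-1)], in which [cf11] is the
    multiplication by a constant, [s] is at most one fifth of [t]. *)
Definition golden_closer s t :=
  5 * (s - phi) * (t + phi - 1) <= (t - phi) * (s + phi - 1).

Lemma golden_closer_cf11 s t : 1 < s -> 1 < t ->
  golden_closer s t -> golden_closer (cf11 s) (cf11 t).
Proof.
move=> s1 t1 h.
move: h; rewrite /golden_closer -subr_ge0 => h; rewrite -subr_ge0.
move: (phi) (@golden_sqr R) (@golden_lb R) (@golden_ub R) h => f g gl gu h.
have e1 x : 1 < x -> cf11 x - f = (2 - f) * (x - f) / (x + 1).
  move=> x1; rewrite (_ : (2 - f) * _ = (2 * x + 1) - f * (x + 1)); last first.
    by rewrite mulrBl mulrBr; rewrite mulrBr g; ring.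
  by rewrite /cf11; field; lra.
have e2 x : 1 < x -> cf11 x + f - 1 = (1 + f) * (x + f - 1) / (x + 1).
  move=> x1; rewrite (_ : (1 + f) * _ = (2 * x + 1) + (f - 1) * (x + 1)); last first.
    by rewrite mulrDl mul1r !mulrDr g; ring.
  by rewrite /cf11; field; lra.
rewrite !e1 // !e2 //.
rewrite (_ : _ - _ = (2 - f) * (1 + f) / ((s + 1) * (t + 1)) *
  ((t - f) * (s + f - 1) - 5 * (s - f) * (t + f - 1))); last first.
  by field; lra.
apply: mulr_ge0 => //; apply: divr_ge0; apply: mulr_ge0; lra.
Qed.

Lemma golden_closer_iter n s t : 1 < s -> 1 < t ->
  golden_closer s t -> golden_closer (iter n cf11 s) (iter n cf11 t).
Proof.
move=> s1 t1 h; elim: n => //= n IH.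
by apply: golden_closer_cf11 => //; exact: iter_cf11_gt1.
Qed.

Lemma golden_closer_base y q : phi < y < 12 / 5 -> 7 / 3 < q ->
  golden_closer (cf11 y) q.
Proof.
move=> /andP[yphi y2] q7.
have gl := @golden_lb R; have gu := @golden_ub R.
have y1 : 1 < y by lra.
have p2 : cf11 y < 29 / 17 by rewrite /cf11 ltr_pdivrMr; lra.
have p1 := cf11_golden_gt yphi; rewrite /golden_closer.
move: (phi) (cf11 y) gl gu p1 p2 => f p gl gu p1 p2 {yphi y1 y2 y}.
have k1 : 25 * (p - f) <= p + f - 1 by lra.
have k2 : q + f - 1 <= 5 * (q - f) by lra.
have k3 : 0 <= (5 * (q - f) - (q + f - 1)) * (p - f) by apply: mulr_ge0; lra.
have k4 : 0 <= (p + f - 1 - 25 * (p - f)) * (q - f) by apply: mulr_ge0; lra.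
lra.
Qed.

(** This contradicts [twin_bound] with [s] and [t] exchanged: no block has
    one side so much closer to [phi] than the other one. *)
Lemma golden_closer_bound s t : phi < s < 2 -> phi < t < 2 ->
  golden_closer s t -> 5 * s * t + 2 * s + 2 * t + 1 <= (6 * phi + 3) * t.
Proof.
rewrite /golden_closer.
move: (phi) (@golden_sqr R) (@golden_lb R) => f g gl hs ht h.
have st : s <= t by nra.
have k : 5 * (s - f) <= t - f.
  have : (5 * (s - f)) * (t + f - 1) <= (t - f) * (t + f - 1).
    by apply: le_trans h _; apply: ler_wpM2l; lra.
  by rewrite ler_pM2r; lra.
have k1 : 0 <= (2 - t) * (s - f) by apply: mulr_ge0; lra.
have k2 : 0 <= (f - 3 / 2) * (t - f) by apply: mulr_ge0; lra.
nra.
Qed.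

(** If the run on the side of [s] were longer, then [s] would be so much closer
    to [phi] than [t] that the block would violate [twin_bound]. *)
Lemma twin_nlt s t s1 t1 (a b : nat) : twin s t -> 1 < s1 < 2 -> 1 < t1 < 2 ->
  s = iter a cf11 (cf2 (cf2 s1)) -> t = iter b cf11 (cf2 (cf2 t1)) ->
  (a <= b)%N.
Proof.
move=> tw hs1 ht1 es et; rewrite leqNgt; apply/negP => ab.
have ea : a = (b + (a - b).-1.+1)%N.
  by rewrite prednK ?subn_gt0 // subnKC // ltnW.
have /andP[z1 z2] := cf22_bounds hs1; have /andP[z3 z4] := cf22_bounds ht1.
(* [y] is left of [s] after the removal of a run as long as that of [t] and
   of one more pair of 1s. *)
set y := iter (a - b).-1%N cf11 (cf2 (cf2 s1)).
have yphi : phi < y by apply: iter_cf11_golden_gt; have := @golden_ub R; lra.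
have y2 : y < 12 / 5.
  rewrite /y; case: (_.-1) => [|k] /=; first by [].
  have /cf11_bounds/andP[_ h] : 1 < iter k cf11 (cf2 (cf2 s1)).
    by apply: iter_cf11_gt1; lra.
  by apply: lt_trans h _; lra.
have cst : golden_closer s t.
  rewrite es et ea iterD; apply: golden_closer_iter.
  - by rewrite iterS; have := cf11_golden_gt yphi; have := @golden_lb R; rewrite -/y; lra.
  - by lra.
  - by apply: golden_closer_base; rewrite ?yphi.
have sphi := twin_golden sysG small tw.
have tphi := twin_golden sysG small (twin_sym sysG tw).
have bd := twin_bound sysG small (twin_sym sysG tw); case: tw => /andP[_ s2] /andP[_ t2] _.
have := golden_closer_bound (ltac:(apply/andP; split; [exact: sphi|exact: s2]))
  (ltac:(apply/andP; split; [exact: tphi|exact: t2])) cst.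
by rewrite leNgt bd.
Qed.

Lemma cf11_lip x y : 1 < x -> 1 < y -> `|cf11 x - cf11 y| <= `|x - y|.
Proof.
move=> x1 y1.
have -> : cf11 x - cf11 y = ((x + 1) * (y + 1))^-1 * (x - y).
  by rewrite /cf11; field; lra.
rewrite normrM ger0_norm ?invr_ge0; last by nra.
apply: ler_piMl => //; rewrite invf_le1; nra.
Qed.

Lemma iter_cf11_lip n x y : 1 < x -> 1 < y ->
  `|iter n cf11 x - iter n cf11 y| <= `|x - y|.
Proof.
move=> x1 y1; elim: n => //= n IH; apply: le_trans IH.
by apply: cf11_lip; exact: iter_cf11_gt1.
Qed.

Lemma cf22_contract x y : 1 < x -> 1 < y ->
  3 / 2 * `|cf2 (cf2 x) - cf2 (cf2 y)| <= `|x - y|.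
Proof.
move=> x1 y1.
have -> : cf2 (cf2 x) - cf2 (cf2 y) = ((2 * x + 1) * (2 * y + 1))^-1 * (x - y).
  by rewrite /cf2; field; rewrite ?invr_eq0; lra.
rewrite normrM ger0_norm ?invr_ge0; last by nra.
have : ((2 * x + 1) * (2 * y + 1))^-1 <= 2 / 3.
  by rewrite -[2 / 3]invf_div lef_pV2 ?posrE; nra.
by have := normr_ge0 (x - y); nra.
Qed.

(** By [twin_nlt] the runs of 1s on both sides of a block are equally long.
    Passing to the next block preserves this length, so [s] and [t] lie in a
    set on which the inverse of a fixed contraction can be iterated forever. *)
Lemma twin_periodic s t : twin s t -> exists n, forall c : R, 1 < c ->
  iter n cf11 (cf2 (cf2 c)) = c -> s = c /\ t = c.
Proof.
move=> tw; have [n [t1 [et tw1]]] := twin_run tw.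
have [m [s1 [es tws1]]] := twin_run (twin_sym sysG tw).
have ht1 : 1 < t1 < 2 by case: tw1.
have hs1 : 1 < s1 < 2 by case: tws1.
have emn : m = n.
  apply/eqP; rewrite eqn_leq (twin_nlt tw hs1 ht1 es et).
  by rewrite (twin_nlt (twin_sym sysG tw) ht1 hs1 et es).
rewrite {}emn in es; exists n => c c1 ec.
pose P t := exists s s1,
  [/\ twin s t, 1 < s1 < 2 & s = iter n cf11 (cf2 (cf2 s1))].
have Pc : forall t, P t -> t = c.
  apply: (@expanding_bounded R P c (1 + c)).
    move=> u [? [? [[_ hu _] _ _]]]; by rewrite ler_norml; lra.
  move=> u [v [v1 [twu hv1 ev]]].
  have [k [u1 [eu twu1]]] := twin_run twu.
  have hu1 : 1 < u1 < 2 by case: twu1.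
  have ekn : k = n.
    apply/eqP; rewrite eqn_leq (twin_nlt (twin_sym sysG twu) hu1 hv1 eu ev).
    by rewrite (twin_nlt twu hv1 hu1 ev eu).
  rewrite {}ekn in eu twu1; exists u1.
    exists (iter n cf11 (cf2 (cf2 v))), v; split => //; by case: twu.
  have zc := @cf2_bounds R c c1; have /cf2_bounds zzc : 1 < cf2 c by lra.
  have zu := cf22_bounds hu1.
  rewrite -{1}ec eu.
  have := @iter_cf11_lip n (cf2 (cf2 u1)) (cf2 (cf2 c)).
  have := @cf22_contract u1 c.
  by lra.
by split; apply: Pc; [exists t, t1|exists s, s1]; split => //; exact: twin_sym.
Qed.

(** Subtracting 1 from the first slope as often as possible leads to a pair
    of slopes on the two sides of 1. *)
Lemma slope_cut_exists : (exists a b, G a b) -> exists X Y, cut X Y.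
Proof.
have descend n : forall a b, G a b -> 1 < b -> a < n%:R -> exists X Y, cut X Y.
  elim: n => [|n IH] a b Gab b1 an.
    by have [] := slope_gt0 sysG Gab; lra.
  have [a0 b0] := slope_gt0 sysG Gab.
  have [a1|a1|e] := ltgtP a 1; last by move/eqP: e; rewrite (negbTE (slope_neq1 sysG Gab)).
    exists b, a^-1; split => //; first by rewrite invf_gt1.
    by rewrite invrK; exact: slope_sym.
  apply: (IH _ _ (slope_sub sysG Gab a1)); first by lra.
  by move: an; rewrite -natr1; lra.
move=> [a [b Gab]].
have [a0 b0] := slope_gt0 sysG Gab.
have large x y : G x y -> 1 < y -> exists X Y, cut X Y.
  by move=> Gxy y1; apply: (descend (Num.truncn x).+1 x y) => //; exact: truncnS_gt.
have [b1|b1|e] := ltgtP b 1; last first.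
- by move/eqP: e; rewrite (negbTE (slope_neq1 sysG (slope_sym sysG Gab))).
- exact: large Gab b1.
- by apply: large (slope_inv sysG Gab) _; rewrite invf_gt1.
Qed.

Theorem slope_classification (sfix : nat -> R) :
  (forall n, 1 < sfix n) ->
  (forall n, iter n cf11 (cf2 (cf2 (sfix n))) = sfix n) ->
  (exists a b, G a b) ->
  G phi phi^-1 \/ exists n, G (cf2 (sfix n)) (cf2 (sfix n))^-1.
Proof.
move=> s1 es /slope_cut_exists [X0 [Y0 c0]].
case: (pselect (exists X Y, cut X Y /\ 2 < X)) => [[X [Y [cXY X2]]]|no2]; last first.
  have all1 X Y : cut X Y -> X < 2.
    by move=> c; have [//|X2] := cut_case sysG c; case: no2; exists X, Y.
  left; have := cut_golden sysG all1 (cut_sym sysG c0).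
  have := cut_golden sysG all1 c0.
  by move=> eX eY; case: c0 => _ _; rewrite eX eY.
right; case: (pselect (exists X Y, [/\ cut X Y, 2 < X & Y < 2])) => [|no12].
  move=> [{X2 cXY}X [{}Y [cXY X2 Y2]]].
  have [t _ tw] := cut_twin cXY X2 Y2.
  have [n per] := twin_periodic tw.
  exists n; have [eY et] := per _ (s1 n) (es n).
  by case: tw => _ _; rewrite eY et => -[].
have all2 A B : cut A B -> 2 < A -> 2 < B.
  move=> c A2; have [B2|//] := cut_case sysG (cut_sym sysG c).
  by case: no12; exists A, B.
(* Without 1s in the period, the periodic expansion has all digits 2. *)
exists 0%N; have := s1 0%N; have := es 0%N; set c := sfix 0%N => /= ec c1.
have d2 := cf2_bounds c1.
have /andP[c2 _] : 2 < c < 3 by rewrite -[c in _ < c < _]ec; apply: cf2_bounds; lra.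
have ec2 : cf2 c = c.
  have k1 : cf2 c * c = 2 * c + 1 by rewrite /cf2; field; lra.
  have e : c = 2 + (cf2 c)^-1 by rewrite -{1}ec.
  have k2 : cf2 c * c = 2 * cf2 c + 1.
    by rewrite {2}e mulrDr divff ?[_ * 2]mulrC //; apply/eqP; lra.
  lra.
have eX := cut_silver sysG small c2 ec2 all2 cXY X2.
have eY := cut_silver sysG small c2 ec2 all2 (cut_sym sysG cXY) (all2 _ _ cXY X2).
by case: cXY => _ _; rewrite eX eY ec2.
Qed.
End Classification.

(** * Slopes with rational trace *)

(** The Fibonacci numbers of indices [2 * n + 1] and [2 * n]; they are the
    coefficients of the iterates of [cf11], see [iter_cf11E]. *)
Fixpoint fib_pair (n : nat) : nat * nat :=
  if n is m.+1 then
    let: (f, g) := fib_pair m in (2 * f + g, f + g)%N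
  else (1, 0)%N.

Lemma fib_pair_det n (f := (fib_pair n).1) (g := (fib_pair n).2) :
  (f * f = 1 + f * g + g * g)%N.
Proof.
rewrite /f /g {f g}; elim: n => //= n; case: (fib_pair n) => f g /=; nia.
Qed.

Lemma fib_pair_gt n : (n < (fib_pair n).1)%N.
Proof. by elim: n => //= n; case: (fib_pair n) => f g /=; lia. Qed.

Lemma fib_pair_ltn n : ((fib_pair n).2 < (fib_pair n).1)%N.
Proof. by elim: n => //= n; case: (fib_pair n) => f g /=; lia. Qed.

Section QuadraticSlopes.
Context {R : realType}.
Implicit Types b c d : R.

(** The positive root of [X ^+ 2 - b * X - 1]; the other one is its negated
    inverse. *)
Definition quad_slope b : R := (b + Num.sqrt (b ^+ 2 + 4)) / 2.

(** The normalized dispersion of the extremal lattice with slopes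
    [quad_slope b] and [(quad_slope b)^-1]. *)
Definition slope_value b : R := 1 + (b + 1) / Num.sqrt (b ^+ 2 + 4).

Lemma sqr_disc b : Num.sqrt (b ^+ 2 + 4) * Num.sqrt (b ^+ 2 + 4) = b * b + 4.
Proof. by rewrite -expr2 sqr_sqrtr ?expr2 //; nra. Qed.

Lemma disc_gt0 b : 0 < Num.sqrt (b ^+ 2 + 4).
Proof. by rewrite sqrtr_gt0 expr2; nra. Qed.

Lemma quad_slopeE b : quad_slope b * quad_slope b = b * quad_slope b + 1.
Proof. by rewrite /quad_slope; have := sqr_disc b; lra. Qed.

Lemma quad_slope_gt0 b : 0 < quad_slope b.
Proof. by rewrite /quad_slope; have := sqr_disc b; have := disc_gt0 b; nra. Qed.

Lemma quad_slope_inv b : (quad_slope b)^-1 = quad_slope b - b.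
Proof.
have d0 := quad_slope_gt0 b.
apply: (mulfI (lt0r_neq0 d0)); rewrite divff ?lt0r_neq0 //.
by have := quad_slopeE b; lra.
Qed.

Lemma quad_slope_sum b : quad_slope b + (quad_slope b)^-1 = Num.sqrt (b ^+ 2 + 4).
Proof. by rewrite quad_slope_inv /quad_slope; lra. Qed.

Lemma quad_slope_unique b d : 0 < d -> d * d = b * d + 1 -> quad_slope b = d.
Proof.
move=> d0 e; have q0 := quad_slope_gt0 b; have eq := quad_slopeE b.
apply/eqP; rewrite -subr_eq0; apply/eqP.
have : (quad_slope b - d) * (quad_slope b * d + 1) = 0.
  by rewrite mulrBl !mulrDr; nra.
by move/eqP; rewrite mulf_eq0 => /orP[/eqP //|/eqP]; nra.
Qed.

Lemma quad_slope_golden : quad_slope 1 = golden.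
Proof.
apply: quad_slope_unique; first by have := @golden_lb R; lra.
by rewrite golden_sqr; lra.
Qed.

Lemma quad_slope_sqrt5 : quad_slope (Num.sqrt 5) = golden ^+ 2.
Proof.
rewrite expr2; apply: quad_slope_unique; first by have := @golden_lb R; nra.
by rewrite sqrt5E golden_sqr; have := @golden_sqr R; lra.
Qed.

Lemma slope_value_lt b c : 0 <= b -> b < c -> c <= 3 ->
  slope_value b < slope_value c.
Proof.
move=> b0 bc c3; rewrite /slope_value ltrD2l.
have B0 := disc_gt0 b; have C0 := disc_gt0 c.
rewrite ltr_pdivrMr // mulrAC ltr_pdivlMr //.
have c0 : 0 <= c by lra.
rewrite -ltr_sqr ?nnegrE; [|by apply: mulr_ge0; lra|by apply: mulr_ge0; lra].
rewrite !exprMn !sqr_sqrtr; [|by rewrite expr2; nra|by rewrite expr2; nra].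
rewrite -subr_gt0.
rewrite (_ : _ - _ = (c - b) * (3 * (b + c) - 2 * b * c + 8)); last by ring.
by apply: mulr_gt0; nra.
Qed.

(** The trace of the quadratic irrational with period 2, 1, ..., 1, 2, where
    1 occurs [2 * n] times. *)
Definition slope_trace (n : nat) : R :=
  let: (f, g) := fib_pair n in (4 * f%:R + 3 * g%:R) / (2 * f%:R + g%:R).

Lemma fib_pair_detR n (f := (fib_pair n).1%:R : R) (g := (fib_pair n).2%:R : R) :
  f * f = 1 + f * g + g * g.
Proof. by rewrite /f /g -!natrM fib_pair_det !natrD. Qed.

Lemma slope_trace_succ n : slope_trace n < slope_trace n.+1.
Proof.
rewrite /slope_trace /=; have := fib_pair_detR n; have := fib_pair_gt n.
case: (fib_pair n) => f g /=; rewrite natrD natrM natrD.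
case: f => // f _ e; have f0 : 0 < f.+1%:R :> R by [].
have g0 : 0 <= g%:R :> R by [].
move: f.+1%:R g%:R f0 g0 e => {f g} f g f0 g0 e.
have h : 0 < 2 * f + g by lra.
have h' : 0 < 2 * (2 * f + g) + (f + g) by lra.
rewrite ltr_pdivrMr // mulrAC ltr_pdivlMr // -subr_gt0.
rewrite (_ : _ - _ = 2 * (f * f - f * g - g * g)); last by ring.
by lra.
Qed.

Lemma slope_trace_lt m n : (m < n)%N -> slope_trace m < slope_trace n.
Proof.
move=> mn; rewrite -(subnKC mn); elim: (n - m.+1)%N => [|k IH].
  by rewrite addn0; exact: slope_trace_succ.
by rewrite addnS; apply: lt_trans IH (slope_trace_succ _).
Qed.

(** Writing [b] for the trace and [h] for its denominator, the determinant
    identity of [fib_pair] says [(h * sqrt 5) ^+ 2 - (h * b) ^+ 2 = 4]. *)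
Lemma slope_trace_sqrt5 n :
  0 < Num.sqrt 5 - slope_trace n <= 4 / n.+1%:R.
Proof.
have e5 : Num.sqrt 5 * Num.sqrt 5 = 5 :> R by rewrite -expr2 sqr_sqrtr.
have s5 : 0 <= Num.sqrt 5 :> R by apply: sqrtr_ge0.
move: (Num.sqrt 5 : R) e5 s5 => r e5 s5.
rewrite /slope_trace /=; have := fib_pair_detR n.
have : n.+1%:R <= (fib_pair n).1%:R :> R by rewrite ler_nat fib_pair_gt.
case: (fib_pair n) => f g /=.
have n0 : 1 <= n.+1%:R :> R by rewrite ler1n.
have g0 : 0 <= g%:R :> R by [].
move: f%:R g%:R n.+1%:R n0 g0 => {f g} f g m m0 g0 fm e.
have h : 0 < 2 * f + g by lra.
have e4 : (2 * f + g) * r * ((2 * f + g) * r) =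
    (4 * f + 3 * g) * (4 * f + 3 * g) + 4.
  rewrite mulrACA e5; lra.
rewrite -(pmulr_rgt0 _ h).
have eh : (2 * f + g) * (r - (4 * f + 3 * g) / (2 * f + g)) =
    (2 * f + g) * r - (4 * f + 3 * g).
  by field; lra.
have A0 : 0 <= (2 * f + g) * r by apply: mulr_ge0 => //; lra.
have B1 : 1 <= 4 * f + 3 * g by lra.
have [k k4] : 0 < (2 * f + g) * r - (4 * f + 3 * g) /\
    (2 * f + g) * r - (4 * f + 3 * g) <= 4.
  by move: (_ * r) (4 * f + _) e4 A0 B1 => A B e4 A0 B1; split; nra.
rewrite eh k /= -(ler_pM2l h) eh; move: k4.
move=> /le_trans; apply.
by rewrite mulrA ler_pdivlMr; nra.
Qed.

Lemma slope_trace_ge2 n : 2 <= slope_trace n.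
Proof.
have e0 : slope_trace 0 = 2 by rewrite /slope_trace /=; field.
case: n => [|n]; first by rewrite e0.
by rewrite -{1}e0; apply/ltW/slope_trace_lt.
Qed.

Lemma sqrt5_lt : Num.sqrt 5 < 9 / 4 :> R.
Proof. by have := @golden_ub R; rewrite sqrt5E; lra. Qed.

Lemma quad_slope_bounds b : 2 <= b < 9 / 4 -> 2 < quad_slope b < 3.
Proof.
move=> hb; have := quad_slopeE b; have := quad_slope_gt0 b.
by move: (quad_slope b) => d d0 e; nra.
Qed.

Lemma slope_trace_bounds n : 2 <= slope_trace n < 9 / 4.
Proof.
rewrite slope_trace_ge2 /=; apply: lt_trans sqrt5_lt.
by have := slope_trace_sqrt5 n; lra.
Qed.

Definition periodic_slope n := quad_slope (slope_trace n).
(** The expansion that starts after the first digit 2 of [periodic_slope]. *)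
Definition periodic_tail n := (periodic_slope n - 2)^-1.

Lemma periodic_slope_bounds n : 2 < periodic_slope n < 3.
Proof. exact/quad_slope_bounds/slope_trace_bounds. Qed.

Lemma periodic_tail_gt1 n : 1 < periodic_tail n.
Proof. by have h := periodic_slope_bounds n; rewrite /periodic_tail invf_gt1; lra. Qed.

Lemma cf2_periodic_tail n : cf2 (periodic_tail n) = periodic_slope n.
Proof. by have /andP[h _] := periodic_slope_bounds n; exact: cf2K. Qed.

Lemma iter_cf11E n (x : R) : 1 < x ->
  let: (f, g) := fib_pair n in
  iter n cf11 x = (f%:R * x + g%:R) / (g%:R * x + (f%:R - g%:R)).
Proof.
move=> x1; elim: n => [|n IH]; first by rewrite /=; field.
have := iter_cf11_gt1 n x1.
rewrite /= -/(fib_pair n); have := fib_pair_ltn n.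
case: (fib_pair n) IH => f g -> /= gf _.
have {}gf : g%:R < f%:R :> R by rewrite ltr_nat.
have g0 : 0 <= g%:R :> R by [].
rewrite natrD natrM natrD; move: f%:R g%:R gf g0 => {}f {}g gf g0.
rewrite /cf11; field; nra.
Qed.

(** The digits 1, ..., 1, 2, 2 lead from the tail back to itself. *)
Lemma periodic_tailE n :
  iter n cf11 (cf2 (periodic_slope n)) = periodic_tail n.
Proof.
have hd := periodic_slope_bounds n.
have z1 : 1 < cf2 (periodic_slope n) by have := @cf2_bounds R (periodic_slope n); lra.
have e := quad_slopeE (slope_trace n); rewrite -/(periodic_slope n) in e.
have := iter_cf11E n z1; rewrite /periodic_tail.
have := fib_pair_ltn n; move: e; rewrite /slope_trace.
case: (fib_pair n) => f g /= e gf ->.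
have {}gf : g%:R < f%:R :> R by rewrite ltr_nat.
have g0 : 0 <= g%:R :> R by [].
move: (periodic_slope n) f%:R g%:R hd z1 e gf g0 => d {}f {}g hd z1 e gf g0.
have {}e : (2 * f + g) * (d * d - 1) = (4 * f + 3 * g) * d.
  by rewrite e; field; lra.
have ez : cf2 d = (2 * d + 1) / d by rewrite /cf2; field; lra.
have den : 0 < g * (2 * d + 1) + (f - g) * d.
  by apply: ltr_wpDl; [apply: mulr_ge0|apply: mulr_gt0]; lra.
apply: (mulIf (_ : d - 2 != 0)); first by apply/eqP; lra.
rewrite mulVf; last by apply/eqP; lra.
rewrite ez (_ : _ * (d - 2) =
  ((f * (2 * d + 1) + g * d) * (d - 2)) / (g * (2 * d + 1) + (f - g) * d)).
  by rewrite (_ : _ * (d - 2) = g * (2 * d + 1) + (f - g) * d) ?divff //; lra.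
by field; rewrite ?mulf_neq0; lra.
Qed.
End QuadraticSlopes.

(** * Lattices, empty boxes and NBA equivalence *)

Section Matrices22.
Implicit Types (T : nzRingType).

Lemma ord2P (P : 'I_2 -> Prop) : P 0 -> P 1 -> forall i, P i.
Proof.
move=> P0 P1 [[|[|//]] h]; [rewrite (_ : Ordinal h = 0)|rewrite (_ : Ordinal h = 1)] => //;
  exact: val_inj.
Qed.

Lemma sum_ord2 T (F : 'I_2 -> T) : \sum_i F i = F 0 + F 1.
Proof.
rewrite !big_ord_recl big_ord0 addr0; congr (_ + F _); exact: val_inj.
Qed.

Lemma mx22_eta (T : Type) (A : 'M[T]_2) : A = mx22 (A 0 0) (A 0 1) (A 1 0) (A 1 1).
Proof. by apply/matrixP; do 2!apply: ord2P; rewrite mxE. Qed.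

Lemma mul_mx22 T (a b c d a' b' c' d' : T) :
  mx22 a b c d *m mx22 a' b' c' d' =
  mx22 (a * a' + b * c') (a * b' + b * d') (c * a' + d * c') (c * b' + d * d').
Proof. by apply/matrixP; do 2!apply: ord2P; rewrite !mxE sum_ord2 !mxE. Qed.

Lemma map_mx22 (T T' : Type) (f : T -> T') a b c d :
  map_mx f (mx22 a b c d) = mx22 (f a) (f b) (f c) (f d).
Proof. by apply/matrixP; do 2!apply: ord2P; rewrite !mxE. Qed.

Lemma det_mx22 (T : comNzRingType) (a b c d : T) :
  \det (mx22 a b c d) = a * d - b * c.
Proof.
rewrite (expand_det_row _ 0) sum_ord2 /cofactor !det_mx11 !mxE /=.
by rewrite expr0 expr1 mul1r mulN1r mulrN.
Qed.

End Matrices22.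

Section LatticeBoxes.
Context {R : realType}.
Implicit Types (A B : 'M[R]_2) (l r p q w : R).

Definition lattice_point A (m n : int) (i : 'I_2) : R :=
  A i 0 * m%:~R + A i 1 * n%:~R.

Lemma lattice_point_mulmx A B m n i : lattice_point (A *m B) m n i =
  A i 0 * lattice_point B m n 0 + A i 1 * lattice_point B m n 1.
Proof. by rewrite /lattice_point !mxE !sum_ord2; ring. Qed.

(** The open box [l < x < r], [p < y < q] contains no lattice point. *)
Definition empty_box A l r p q := forall m n : int,
  l < lattice_point A m n 0 < r -> p < lattice_point A m n 1 < q -> False.

Lemma empty_boxP A l r p q :
  open_box l r p q `&` lattice_of A = set0 <-> empty_box A l r p q.
Proof.
split=> [h m n hx hy|h].
  pose z : 'cV[int]_2 := \col_(i < 2) if i == 0 then m else n.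
  have zE i : (A *m map_mx intr z) i 0 = lattice_point A m n i.
    by rewrite mxE sum_ord2 !mxE.
  suff : (open_box l r p q `&` lattice_of A) (A *m map_mx intr z) by rewrite h.
  by split; [rewrite /open_box /= !zE|exists z].
apply/seteqP; split=> // v [[hx hy] [z _ zv]].
have vE i : v i 0 = lattice_point A (z 0 0) (z 1 0) i.
  by rewrite -zv mxE sum_ord2 !mxE.
by apply: (h (z 0 0) (z 1 0)); rewrite -vE.
Qed.

Lemma det_gt0 A : A \in unitmx -> 0 < `|\det A|.
Proof. by rewrite unitmxE unitfE normr_gt0. Qed.

Lemma ndispE A : A \in unitmx ->
  ndisp (lattice_of A) = (disp (lattice_of A) * (`|\det A|^-1)%:E)%E.
Proof. by move=> uA; rewrite /ndisp lattice_det_of. Qed.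

Lemma ndisp_ge A l r p q : A \in unitmx -> l < r -> p < q ->
  empty_box A l r p q ->
  (((r - l) * (q - p) / `|\det A|)%:E <= ndisp (lattice_of A))%E.
Proof.
move=> uA lr pq /empty_boxP eb; rewrite ndispE // EFinM.
apply: lee_wpmul2r; first by rewrite lee_fin invr_ge0.
by apply: ereal_sup_ubound; exists l, r, p, q.
Qed.

Lemma ndisp_le A (v : \bar R) : A \in unitmx ->
  (forall l r p q, l < r -> p < q -> empty_box A l r p q ->
     (((r - l) * (q - p) / `|\det A|)%:E <= v)%E) ->
  (ndisp (lattice_of A) <= v)%E.
Proof.
move=> uA h; have d0 := det_gt0 uA; rewrite ndispE // lee_pdivrMr //.
apply: ub_ereal_sup => _ [l [r [p [q [lr pq /empty_boxP eb ->]]]]].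
by rewrite -lee_pdivrMr // -EFinM; exact: h.
Qed.

(** All invariance properties of [ndisp] come from maps between empty boxes
    that preserve the normalized area. *)
Lemma ndisp_transfer A B : A \in unitmx -> B \in unitmx ->
  (forall l r p q, l < r -> p < q -> empty_box A l r p q ->
     exists l' r' p' q', [/\ l' < r', p' < q', empty_box B l' r' p' q' &
       (r - l) * (q - p) / `|\det A| = (r' - l') * (q' - p') / `|\det B|]) ->
  (ndisp (lattice_of A) <= ndisp (lattice_of B))%E.
Proof.
move=> uA uB h; apply: ndisp_le => // l r p q lr pq eb.
have [l' [r' [p' [q' [lr' pq' eb' ->]]]]] := h _ _ _ _ lr pq eb.
exact: ndisp_ge.
Qed.

Lemma scale_interval (a l r : R) : a != 0 -> l < r -> exists l' r',
  [/\ l' < r', r' - l' = (r - l) / `|a| & forall x, l' < x < r' -> l < a * x < r].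
Proof.
move=> a0 lr; case: (ltgtP a 0) a0 => // a0 _.
- exists (r / a), (l / a); split.
  + by rewrite ltr_nM2r ?invr_lt0.
  + by rewrite ltr0_norm // invrN mulrN -mulNr opprB mulrBl.
  + move=> x; rewrite ltr_ndivrMr // ltr_ndivlMr // ![x * a]mulrC; lra.
- exists (l / a), (r / a); split.
  + by rewrite ltr_pM2r ?invr_gt0.
  + by rewrite gtr0_norm // mulrBl.
  + by move=> x; rewrite ltr_pdivrMr // ltr_pdivlMr // ![x * a]mulrC.
Qed.

Lemma ndisp_diag_le (a b : R) A : a * b != 0 -> A \in unitmx ->
  (ndisp (lattice_of (mx22 a 0 0 b *m A)%R) <= ndisp (lattice_of A))%E.
Proof.
move=> ab0 uA; have [a0 b0] : a != 0 /\ b != 0 by apply/andP; rewrite -negb_or -mulf_eq0.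
have dE : \det (mx22 a 0 0 b *m A) = a * b * \det A.
  by rewrite det_mulmx det_mx22 mul0r subr0.
have d0 := det_gt0 uA.
apply: ndisp_transfer => //.
  by rewrite unitmxE dE unitfE mulf_neq0 // -normr_gt0.
move=> l r p q lr pq eb.
have [l' [r' [lr' el hl]]] := scale_interval a0 lr.
have [p' [q' [pq' ep hp]]] := scale_interval b0 pq.
exists l', r', p', q'; split => //.
  by move=> m n /hl hx /hp hy; apply: (eb m n); rewrite lattice_point_mulmx;
    rewrite !mxE /= mul0r ?addr0 ?add0r.
rewrite el ep dE !normrM; field.
by rewrite !normr_eq0 a0 b0 -[\det A != 0]normr_gt0 d0.
Qed.

Lemma ndisp_swap_le A : A \in unitmx ->
  (ndisp (lattice_of (mx22 0 1 1 0 *m A)%R) <= ndisp (lattice_of A))%E.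
Proof.
move=> uA.
have dE : `|\det (mx22 0 1 1 0 *m A)| = `|\det A|.
  by rewrite det_mulmx det_mx22 normrM mul0r mulr1 sub0r normrN1 mul1r.
apply: ndisp_transfer => //.
  by rewrite unitmxE unitfE -normr_gt0 dE det_gt0.
move=> l r p q lr pq eb; exists p, q, l, r; split => //; last by rewrite dE [(r - l) * _]mulrC.
by move=> m n hx hy; apply: (eb m n); rewrite lattice_point_mulmx;
  rewrite !mxE /= mul0r mul1r ?addr0 ?add0r.
Qed.

Lemma lattice_of_unimodular (U : 'M[int]_2) A : U \in unitmx ->
  lattice_of (A *m map_mx intr U) = lattice_of A.
Proof.
move=> uU; apply/seteqP; split => v [z _ <-].
  by exists (U *m z) => //; rewrite map_mxM mulmxA.
exists (invmx U *m z) => //.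
by rewrite -mulmxA -map_mxM mulmxA mulmxV // mul1mx.
Qed.

Lemma unitmx_unimodular (U : 'M[int]_2) A : U \in unitmx -> A \in unitmx ->
  A *m map_mx intr U \in unitmx.
Proof.
move=> uU uA; rewrite unitmx_mul uA /=.
have := congr1 (map_mx (intr : int -> R)) (mulmxV uU).
by rewrite map_mxM map_mx1 => /mulmx1_unit [].
Qed.

Lemma swap_mxK (A : 'M[R]_2) : mx22 0 1 1 0 *m (mx22 0 1 1 0 *m A) = A.
Proof.
rewrite mulmxA mul_mx22 [RHS]mx22_eta [A in LHS]mx22_eta mul_mx22.
by congr mx22; ring.
Qed.

Lemma nba_mx_unit A B : nba_mx A B -> A \in unitmx -> B \in unitmx.
Proof.
move=> + uA; elim => {B} //.
- move=> a b B ab0 _ uB; rewrite unitmx_mul uB andbT unitmxE det_mx22 unitfE.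
  by rewrite mul0r subr0.
- move=> B _ uB; rewrite unitmx_mul uB andbT unitmxE det_mx22 unitfE.
  by rewrite mul0r mulr1 sub0r oppr_eq0 oner_eq0.
- by move=> U B uU _ uB; exact: unitmx_unimodular.
Qed.

Lemma ndisp_nba A B : A \in unitmx -> nba_mx A B ->
  ndisp (lattice_of A) = ndisp (lattice_of B).
Proof.
move=> uA; elim => {B} //.
- move=> a b B ab0 /nba_mx_unit /(_ uA) uB ->; apply/eqP; rewrite eq_le.
  rewrite ndisp_diag_le // andbT.
  have [a0 b0] : a != 0 /\ b != 0 by apply/andP; rewrite -negb_or -mulf_eq0.
  have {1}-> : B = mx22 a^-1 0 0 b^-1 *m (mx22 a 0 0 b *m B).
    rewrite mulmxA mul_mx22 [LHS]mx22_eta [B in RHS]mx22_eta mul_mx22.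
    by congr mx22; field.
  apply: ndisp_diag_le; first by rewrite mulf_neq0 // invr_eq0.
  by apply: nba_mx_unit uB; apply: nba_diag => //; exact: nba_refl.
- move=> B /nba_mx_unit /(_ uA) uB ->; apply/eqP; rewrite eq_le.
  rewrite ndisp_swap_le // andbT -{1}(swap_mxK B); apply: ndisp_swap_le.
  by apply: nba_mx_unit uB; apply: nba_swap; exact: nba_refl.
- by move=> U B uU _ ->; rewrite lattice_of_unimodular.
Qed.

Lemma nba_mx_trans A B C : nba_mx A B -> nba_mx B C -> nba_mx A C.
Proof.
move=> hAB; elim => {C} //.
- by move=> a b C ab0 _; exact: nba_diag.
- by move=> C _; exact: nba_swap.
- by move=> U C uU _; exact: nba_unimodular.
Qed.

End LatticeBoxes.

(** * Bases with one ascending and one descending vector *)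

Section SlopeMatrices.
Context {R : realType}.
Implicit Types (A B : 'M[R]_2) (a b x y : R).

Lemma nba_mx_sym A B : nba_mx A B -> nba_mx B A.
Proof.
elim => {B} [|a b B ab0 _ IH|B _ IH|U B uU _ IH]; first exact: nba_refl.
- apply: nba_mx_trans IH.
  have [a0 b0] : a != 0 /\ b != 0 by apply/andP; rewrite -negb_or -mulf_eq0.
  have {2}-> : B = mx22 a^-1 0 0 b^-1 *m (mx22 a 0 0 b *m B).
    rewrite mulmxA mul_mx22 [LHS]mx22_eta [B in RHS]mx22_eta mul_mx22.
    by congr mx22; field.
  by apply: nba_diag; [rewrite mulf_neq0 // invr_eq0|exact: nba_refl].
- apply: nba_mx_trans IH; rewrite -{2}(swap_mxK B).
  by apply: nba_swap; exact: nba_refl.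
- apply: nba_mx_trans IH.
  have {2}-> : B = B *m map_mx intr U *m map_mx intr (invmx U).
    by rewrite -mulmxA -map_mxM mulmxV // map_mx1 mulmx1.
  by apply: nba_unimodular; [rewrite unitmx_inv|exact: nba_refl].
Qed.

Lemma mx22_unitmx (m n k l : int) : (m * l - n * k) \is a GRing.unit ->
  mx22 m n k l \in unitmx.
Proof. by rewrite unitmxE det_mx22. Qed.

Lemma nba_col a b c d (m n k l : int) : (m * l - n * k) \is a GRing.unit ->
  nba_mx (mx22 a b c d)
    (mx22 (a * m%:~R + b * k%:~R) (a * n%:~R + b * l%:~R)
          (c * m%:~R + d * k%:~R) (c * n%:~R + d * l%:~R) : 'M[R]_2).
Proof.
move=> /mx22_unitmx u; rewrite -mul_mx22 -map_mx22.
by apply: nba_unimodular => //; exact: nba_refl.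
Qed.

Lemma nba_row a b c d x y : x * y != 0 ->
  nba_mx (mx22 a b c d) (mx22 (x * a) (x * b) (y * c) (y * d) : 'M[R]_2).
Proof.
move=> xy; have := nba_diag xy (nba_refl (mx22 a b c d)).
by rewrite mul_mx22 !mul0r !addr0 !add0r.
Qed.

Lemma nba_rowswap a b c d : nba_mx (mx22 a b c d) (mx22 c d a b : 'M[R]_2).
Proof.
have := nba_swap (nba_refl (mx22 a b c d)).
by rewrite mul_mx22 !mul0r !mul1r !addr0 !add0r.
Qed.

Lemma nba_colswap a b c d : nba_mx (mx22 a b c d) (mx22 b a d c : 'M[R]_2).
Proof.
have := @nba_col a b c d 0 1 1 0 isT.
by rewrite !mulr0 !mulr1 !addr0 !add0r.
Qed.

(** It generates the lattice of the points [(m + n * a, m - n * b)]. *)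
Definition slope_mx a b : 'M[R]_2 := mx22 1 a 1 (- b).

Lemma slope_mx_det a b : 0 < a -> 0 < b -> `|\det (slope_mx a b)| = a + b.
Proof.
move=> a0 b0; rewrite det_mx22 (_ : _ - _ = - (a + b)); last by ring.
by rewrite normrN gtr0_norm ?addr_gt0.
Qed.

Lemma slope_mx_unit a b : 0 < a -> 0 < b -> slope_mx a b \in unitmx.
Proof.
by move=> a0 b0; rewrite unitmxE unitfE -normr_gt0 slope_mx_det // addr_gt0.
Qed.

Lemma nba_slope_sym a b : nba_mx (slope_mx a b) (slope_mx b a).
Proof.
apply: nba_mx_trans (nba_rowswap _ _ _ _) _.
have := @nba_col 1 (- b) 1 a 1 0 0 (-1) isT.
by rewrite !mulr0 !mulr1 !addr0 !add0r mulrN1z mulrN1 opprK mulrN1.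
Qed.

Lemma nba_slope_inv a b : 0 < a -> 0 < b ->
  nba_mx (slope_mx a b) (slope_mx a^-1 b^-1).
Proof.
move=> a0 b0; apply: nba_mx_trans (nba_colswap _ _ _ _) _.
have a1 : a != 0 by rewrite gt_eqF.
have b1 : b != 0 by rewrite gt_eqF.
have ab : a^-1 * - b^-1 != 0 by rewrite mulf_neq0 ?oppr_eq0 ?invr_eq0.
by have := @nba_row a 1 (- b) 1 _ _ ab; rewrite mulVf // mulrNN mulVf // !mulr1.
Qed.

Lemma nba_slope_shift a b (k : int) :
  nba_mx (slope_mx a b) (slope_mx (a - k%:~R) (b + k%:~R)).
Proof.
have u : 1 * 1 - - k * 0 \is a GRing.unit by rewrite mulr0 subr0 mulr1 unitr1.
have := @nba_col 1 a 1 (- b) _ _ _ _ u.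
rewrite !mulr0 !mulr1 !addr0 !mul1r mulrNz -opprD.
by rewrite [- _ + a]addrC [k%:~R + b]addrC.
Qed.

Lemma lattice_point_slope x1 x2 y1 y2 m n : 
  (lattice_point (mx22 x1 x2 y1 (- y2) : 'M[R]_2) m n 0 = x1 * m%:~R + x2 * n%:~R) *
  (lattice_point (mx22 x1 x2 y1 (- y2)) m n 1 = y1 * m%:~R - y2 * n%:~R).
Proof. by rewrite /lattice_point !mxE /= mulNr. Qed.

(** The box is spanned by the parallelogram on the two basis vectors.  An
    integer combination strictly between the extreme abscissas has a positive
    and a nonpositive coefficient, and then its ordinate is extreme. *)
Lemma ndisp_slope_ge a b : 0 < a -> 0 < b ->
  ((1 + (1 + a * b) / (a + b))%:E <= ndisp (lattice_of (slope_mx a b)))%E.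
Proof.
move=> a0 b0.
have eb : empty_box (slope_mx a b) 0 (1 + a) (- b) 1.
  move=> m n; rewrite !lattice_point_slope !mul1r => hx hy.
  have [n1|n1|n0] := ltgtP n 0.
  - have [m1|m1] := lerP m 0.
      have : m%:~R <= 0 :> R by rewrite lerz0.
      have : n%:~R < 0 :> R by rewrite ltrz0.
      nra.
    have : 1 <= m%:~R :> R by rewrite ler1z.
    have : n%:~R < 0 :> R by rewrite ltrz0.
    nra.
  - have [m1|m1] := lerP m 0.
      have : m%:~R <= 0 :> R by rewrite lerz0.
      have : 1 <= n%:~R :> R by rewrite ler1z.
      nra.
    have : 1 <= m%:~R :> R by rewrite ler1z.
    have : 1 <= n%:~R :> R by rewrite ler1z.
    nra.
  - move: hx hy; rewrite n0 mulr0z !mulr0 addr0 subr0 ltr0z => /andP[m0 _].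
    by move=> /andP[_]; rewrite ltrz1; move: m0; lia.
have := @ndisp_ge R _ _ _ _ _ (slope_mx_unit a0 b0) (_ : 0 < 1 + a) (_ : - b < 1) eb.
rewrite slope_mx_det // (_ : _ / _ = 1 + (1 + a * b) / (a + b)); last by field; lra.
by apply; lra.
Qed.

(** If the second basis vector is vertical, then the abscissas of lattice
    points form a discrete set, and between two of them there are arbitrarily
    high empty boxes. *)
Lemma ndisp_axis A : A \in unitmx -> A 0 1 = 0 -> ndisp (lattice_of A) = +oo%E.
Proof.
move=> uA A0; have d0 := det_gt0 uA.
have a0 : A 0 0 != 0.
  apply/eqP => a0; move: d0; rewrite [A]mx22_eta det_mx22 a0 A0 !mul0r subrr.
  by rewrite normr0 ltxx.
have {}a0 : 0 < `|A 0 0| by rewrite normr_gt0.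
apply: eq_infty => t; set h := (`|t| + 1) * `|\det A| / `|A 0 0|.
have h0 : 0 < h by rewrite divr_gt0 // mulr_gt0 // ltr_wpDl.
have eb : empty_box A 0 `|A 0 0| 0 h.
  move=> m n; rewrite /lattice_point A0 mul0r addr0 => /andP[p1 p2] _.
  have : `|A 0 0 * m%:~R| < `|A 0 0| by rewrite gtr0_norm.
  rewrite normrM -{2}[`|A 0 0|]mulr1 ltr_pM2l // -intr_norm ltrz1 => m1.
  have m0 : m = 0 by apply/eqP; rewrite -normr_le0; move: m1; lia.
  by move: p1; rewrite m0 mulr0 ltxx.
have := ndisp_ge uA a0 h0 eb; rewrite !subr0; apply: le_trans.
rewrite lee_fin /h mulrCA mulfV ?gt_eqF // mulr1 mulfK ?gt_eqF //.
by have := ler_norm t; lra.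
Qed.

Definition slope_or_infinite A :=
  ndisp (lattice_of A) = +oo%E \/
  exists a b, [/\ 0 < a, 0 < b & nba_mx (slope_mx a b) A].

Lemma slope_or_infinite_nba A B : A \in unitmx -> nba_mx A B ->
  slope_or_infinite A -> slope_or_infinite B.
Proof.
move=> uA AB [h|[a [b [a0 b0 h]]]]; first by left; rewrite -(ndisp_nba uA AB).
by right; exists a, b; split => //; exact: nba_mx_trans AB.
Qed.

Lemma mx1_unit x y : x != y -> (mx22 1 x 1 y : 'M[R]_2) \in unitmx.
Proof. by move=> xy; rewrite unitmxE unitfE det_mx22 mul1r mulr1 subr_eq0 eq_sym. Qed.

Lemma slope_or_infinite_swap x y : x != y ->
  slope_or_infinite (mx22 1 y 1 x) -> slope_or_infinite (mx22 1 x 1 y).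
Proof.
by move=> xy; apply: slope_or_infinite_nba (nba_rowswap _ _ _ _);
  rewrite mx1_unit // eq_sym.
Qed.

Lemma slope_or_infinite_shift (k : int) x y : x != y ->
  slope_or_infinite (mx22 1 (x - k%:~R) 1 (y - k%:~R)) ->
  slope_or_infinite (mx22 1 x 1 y).
Proof.
move=> xy; apply: slope_or_infinite_nba.
  by rewrite mx1_unit // (inj_eq (addIr _)).
have u : 1 * 1 - k * 0 \is a GRing.unit by rewrite mulr0 subr0 mulr1 unitr1.
have := @nba_col 1 (x - k%:~R) 1 (y - k%:~R) _ _ _ _ u.
by rewrite !mulr0 !mulr1 !addr0 !mul1r ![k%:~R + _]addrC !subrK.
Qed.

Lemma slope_or_infinite_inv x y : x != y -> x != 0 -> y != 0 ->
  slope_or_infinite (mx22 1 x^-1 1 y^-1) ->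
  slope_or_infinite (mx22 1 x 1 y).
Proof.
move=> xy x0 y0; apply: slope_or_infinite_nba.
  by rewrite mx1_unit // (inj_eq invr_inj).
apply: nba_mx_trans (nba_colswap _ _ _ _) _.
have := @nba_row x^-1 1 y^-1 1 x y.
by rewrite !mulfV // !mulr1; apply; rewrite mulf_neq0.
Qed.

(** After the subtraction of [k] the second basis vector lies on an axis or
    descends, while the first one ascends. *)
Lemma slope_or_infinite_int (k : int) x y : y <= k%:~R <= x -> x != y ->
  slope_or_infinite (mx22 1 x 1 y).
Proof.
move=> /andP[yk kx] xy; apply: (slope_or_infinite_shift (k := k)) => //.
have xy' : x - k%:~R != y - k%:~R by rewrite (inj_eq (addIr _)).
have [ex|x0] := eqVneq (x - k%:~R) 0.
  by left; apply: ndisp_axis; rewrite ?mx1_unit // mxE.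
have [ey|y0] := eqVneq (y - k%:~R) 0.
  apply: slope_or_infinite_swap => //.
  by left; apply: ndisp_axis; rewrite ?mx1_unit 1?eq_sym // mxE.
right; exists (x - k%:~R), (k%:~R - y); split.
- by rewrite lt_neqAle eq_sym x0 subr_ge0.
- by rewrite subr_gt0 lt_neqAle yk andbT -subr_eq0.
- by rewrite /slope_mx opprB; exact: nba_refl.
Qed.

(** As long as no integer separates [x] from [y], both are shifted by the same
    integer into [-1/2, 1/2] and then inverted, which multiplies their
    distance by at least 4.  At a distance above 1 an integer separates them.
    If this fails because 1/2 separates the fractional parts, then 2 separates
    their inverses. *)
Lemma slope_or_infinite_mx1 x y : x != y -> slope_or_infinite (mx22 1 x 1 y).
Proof.
move=> xy.
have [n] : exists n : nat, 1 < n%:R * `|x - y|.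
  exists (Num.truncn `|x - y|^-1).+1.
  by rewrite -ltr_pdivrMr ?normr_gt0 ?subr_eq0 // div1r truncnS_gt.
elim: n x y xy => [|n IH] x y xy; first by rewrite mul0r; lra.
wlog yx : x y xy / y < x => [wl|].
  have [yx|yx|e] := ltgtP y x; first exact: wl; last by rewrite e eqxx in xy.
  by rewrite distrC => h; apply: slope_or_infinite_swap => //; apply: wl; rewrite // eq_sym.
rewrite gtr0_norm ?subr_gt0 // => big.
pose k := Num.floor x.
have kx : k%:~R <= x by exact: floor_le.
have xk : x < k%:~R + 1 by have := floorD1_gt x; rewrite intrD.
have [yk|ky] := leP y k%:~R; first by apply: (slope_or_infinite_int (k := k)); rewrite ?yk.
have invert u v : u != v -> u - v = x - y ->
    (0 < v /\ u < 1 / 2 \/ - (1 / 2) < v /\ u < 0) ->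
    slope_or_infinite (mx22 1 u 1 v).
  move=> uv euv huv.
  have u0 : u != 0 by apply/eqP; lra.
  have v0 : v != 0 by apply/eqP; lra.
  apply: slope_or_infinite_inv => //; apply: IH; first by rewrite (inj_eq invr_inj).
  have e : v^-1 - u^-1 = (x - y) / (u * v) by rewrite -euv; field; rewrite u0 v0.
  have uv0 : 0 < u * v by nra.
  rewrite distrC e ger0_norm; last by apply: divr_ge0; lra.
  rewrite mulrA ltr_pdivlMr // mul1r.
  have uv4 : 4 * (u * v) <= 1 by nra.
  case: n big => [|n]; first by lra.
  rewrite -[n.+2%:R]natr1.
  have : 1 <= n.+1%:R :> R by rewrite ler1n.
  nra.
have uv : x - k%:~R != y - k%:~R by rewrite (inj_eq (addIr _)).
have [xh|xh] := ltP (x - k%:~R) (1 / 2).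
  by apply: (slope_or_infinite_shift (k := k)) => //; apply: invert => //; lra.
have [yh|yh] := leP (y - k%:~R) (1 / 2); last first.
  apply: (slope_or_infinite_shift (k := k + 1)) => //; apply: invert.
  + by rewrite (inj_eq (addIr _)).
  + by lra.
  + by right; rewrite intrD; lra.
apply: (slope_or_infinite_shift (k := k)) => //.
have v0 : 0 < y - k%:~R by rewrite subr_gt0.
apply: slope_or_infinite_inv => //; [by apply/eqP; lra|by apply/eqP; lra|].
apply: slope_or_infinite_swap; first by rewrite (inj_eq invr_inj).
apply: (slope_or_infinite_int (k := 2)); last by rewrite (inj_eq invr_inj) eq_sym.
have hx : (x - k%:~R)^-1 <= 2 by rewrite -[_^-1]mul1r ler_pdivrMr; lra.
have hy : 2 <= (y - k%:~R)^-1 by rewrite -[_^-1]mul1r ler_pdivlMr; lra.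
by apply/andP; split; [exact: hx|exact: hy].
Qed.

Lemma slope_or_infiniteP A : A \in unitmx -> slope_or_infinite A.
Proof.
move=> uA; rewrite [A]mx22_eta in uA *.
move: (A 0 0) (A 0 1) (A 1 0) (A 1 1) uA => a b c d uA.
have axis m : m \in unitmx -> nba_mx m (mx22 a b c d) -> m 0 1 = 0 ->
    slope_or_infinite (mx22 a b c d).
  move=> um hm m0; apply: (slope_or_infinite_nba um hm).
  by left; exact: ndisp_axis.
have det : a * d - b * c != 0 by rewrite -unitfE -det_mx22 -unitmxE.
have [b0|b0] := eqVneq b 0.
  by apply: (axis _ uA (nba_refl _)); rewrite mxE /= b0.
have [a0|a0] := eqVneq a 0.
  apply: axis (nba_mx_sym (nba_colswap _ _ _ _)) _; last by rewrite mxE /= a0.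
  by apply: nba_mx_unit uA; exact: nba_colswap.
have [d0|d0] := eqVneq d 0.
  apply: axis (nba_mx_sym (nba_rowswap _ _ _ _)) _; last by rewrite mxE /= d0.
  by apply: nba_mx_unit uA; exact: nba_rowswap.
have [c0|c0] := eqVneq c 0.
  have h : nba_mx (mx22 a b c d) (mx22 d c b a).
    exact: nba_mx_trans (nba_colswap _ _ _ _) (nba_rowswap _ _ _ _).
  apply: axis (nba_mx_sym h) _; last by rewrite mxE /= c0.
  exact: nba_mx_unit h uA.
have xy : b / a != d / c.
  by rewrite eqr_div // -subr_eq0 [d * a]mulrC -oppr_eq0 opprB.
apply: slope_or_infinite_nba (mx1_unit xy) _ (slope_or_infinite_mx1 xy).
have ac : a * c != 0 by rewrite mulf_neq0.
by have := nba_row 1 (b / a) 1 (d / c) ac; rewrite !mulr1 ![_ * (_ / _)]mulrC !divfK.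
Qed.

End SlopeMatrices.

(** * Upper bounds for the dispersion *)

Section UpperBound.
Context {R : realType}.
Implicit Types (a b x y : R).

Definition lattice_slopes (A : 'M[R]_2) a b :=
  [/\ 0 < a, 0 < b & nba_mx (slope_mx a b) A].

Lemma lattice_slopes_ndisp A a b : lattice_slopes A a b ->
  ndisp (lattice_of A) = ndisp (lattice_of (slope_mx a b)).
Proof. by case=> a0 b0 /ndisp_nba ->//; exact: slope_mx_unit. Qed.

(** Only the exclusion of the slope 1 is not a base change: the next
    basis would then have a vector on an axis. *)
Lemma lattice_slopes_system A : ndisp (lattice_of A) != +oo%E ->
  slope_system (lattice_slopes A).
Proof.
move=> fin.
have neq1 a b : lattice_slopes A a b -> a != 1.
  move=> sAab; apply: contra_neq fin => a1.
  rewrite (lattice_slopes_ndisp sAab) a1; have [_ b0 _] := sAab.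
  have h : nba_mx (slope_mx 1 b) (slope_mx (1 - 1) (b + 1)).
    exact: nba_slope_shift 1.
  have u := slope_mx_unit ltr01 b0.
  rewrite (ndisp_nba u h); apply: ndisp_axis; first exact: nba_mx_unit h u.
  by rewrite mxE /= subrr.
split => //.
- by move=> a b [].
- move=> a b [a0 b0 h]; split => //; exact: nba_mx_trans (nba_slope_sym _ _) h.
- move=> a b [a0 b0 h]; split; rewrite ?invr_gt0 //.
  apply: nba_mx_trans h; rewrite -{2}[a]invrK -{2}[b]invrK.
  by apply: nba_slope_inv; rewrite invr_gt0.
- move=> a b [a0 b0 h] a1; split; [by rewrite subr_gt0|by rewrite addr_gt0|].
  apply: nba_mx_trans h; have := nba_slope_shift (a - 1) (b + 1) (-1).
  by rewrite mulrN1z opprK subrK addrK.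
Qed.

Lemma first_above (X : nat -> R) (l s d : R) : 0 < s -> X 0%N <= l ->
  (forall n, X n + s <= X n.+1 <= X n + d) -> exists n, l < X n <= l + d.
Proof.
move=> s0 X0 step.
have grow n : X 0%N + n%:R * s <= X n.
  elim: n => [|n IH]; first by rewrite mul0r addr0.
  by rewrite -natr1; have /andP[h _] := step n; apply: le_trans h; nra.
have ex : exists n, l < X n.
  exists (Num.truncn ((l - X 0%N) / s)).+1; apply: lt_le_trans (grow _).
  have : (l - X 0%N) / s < (Num.truncn ((l - X 0%N) / s)).+1%:R by exact: truncnS_gt.
  by rewrite ltr_pdivrMr //; lra.
exists (ex_minn ex); case: ex_minnP => -[|n] lX min; first by lra.
have Xn : X n <= l by rewrite leNgt; apply/negP => /min; rewrite ltnn.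
by have := step n; lra.
Qed.

(** In a horizontal strip of height [y2] there is, for every multiple of the
    first basis vector, exactly one multiple of the second one that brings
    it into the strip.  The points obtained in this way move to the right in steps
    of at most [x1 + x2], so a wider box which contains the strip meets them. *)
Lemma gap_le x1 x2 y1 y2 l r p q : 0 < x1 -> 0 < x2 -> 0 < y1 -> y1 <= y2 ->
  empty_box (mx22 x1 x2 y1 (- y2)) l r p q -> r - l <= x1 + x2 \/ q - p <= y2.
Proof.
move=> x10 x20 y10 y12 eb.
have y20 : 0 < y2 by lra.
have [|xw] := leP (r - l) (x1 + x2); first by left.
have [|yh] := leP (q - p) y2; [by right|exfalso].
(* The strip between [c] and [c + y2] is centred in the box. *)
pose c := (p + (q - y2)) / 2.
pose k (m : int) := Num.floor ((y1 * m%:~R - c) / y2).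
pose X (m : int) := x1 * m%:~R + x2 * (k m)%:~R.
have kP m : c <= y1 * m%:~R - y2 * (k m)%:~R < c + y2.
  have := floor_le ((y1 * m%:~R - c) / y2); rewrite -/(k m) ler_pdivlMr // => h1.
  have := floorD1_gt ((y1 * m%:~R - c) / y2).
  by rewrite -/(k m) intrD ltr_pdivrMr // => h2; lra.
have step m : X m + x1 <= X (m + 1) <= X m + (x1 + x2).
  have := kP m; have := kP (m + 1); rewrite /X intrD => h1 h2.
  have kk : (k m <= k (m + 1) <= k m + 1).
    have e : (k (m + 1))%:~R - (k m)%:~R = (k (m + 1) - k m)%:~R :> R by rewrite intrB.
    have b1 : y2 * (k (m + 1) - k m)%:~R < y2 * 2 by rewrite -e; lra.
    have b2 : y2 * (-1) < y2 * (k (m + 1) - k m)%:~R by rewrite -e; lra.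
    move: b1 b2; rewrite !ltr_pM2l //.
    rewrite -[2]/(2%:~R) -[-1]/((-1)%:~R) !ltr_int; lia.
  case/andP: kk; rewrite -(ler_int R) => k1; rewrite -(ler_int R) intrD => k2.
  nra.
have [m0 Xm0] : exists m0, X m0 <= l.
  pose e := x1 + x2 * (y1 / y2).
  have e0 : 0 < e by rewrite addr_gt0 // mulr_gt0 // divr_gt0.
  exists (Num.floor ((l + x2 * (c / y2)) / e)).
  set m := Num.floor _.
  have := floor_le ((l + x2 * (c / y2)) / e); rewrite -/m ler_pdivlMr // => h1.
  have h2 := floor_le ((y1 * m%:~R - c) / y2); rewrite -/(k m) in h2.
  rewrite /X; apply: le_trans (_ : _ <= x1 * m%:~R + x2 * ((y1 * m%:~R - c) / y2)) _.
    by rewrite lerD2l ler_pM2l.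
  have -> : x1 * m%:~R + x2 * ((y1 * m%:~R - c) / y2) = m%:~R * e - x2 * (c / y2).
    by rewrite /e; field; lra.
  lra.
have [n hn] : exists n : nat, l < X (m0 + n%:Z) <= l + (x1 + x2).
  apply: (@first_above (fun n : nat => X (m0 + n%:Z)) l x1) => //.
    by rewrite addr0.
  by move=> n; rewrite -addn1 PoszD addrA; exact: step.
apply: (eb (m0 + n%:Z) (k (m0 + n%:Z))); rewrite lattice_point_slope.
  by rewrite -/(X _); lra.
by have := kP (m0 + n%:Z); rewrite /c; lra.
Qed.

Lemma empty_box_reflect x1 x2 y1 y2 l r p q :
  empty_box (mx22 x1 x2 y1 (- y2) : 'M[R]_2) l r p q ->
  empty_box (mx22 x2 x1 y2 (- y1)) l r (- q) (- p).
Proof.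
move=> eb m n hx hy; apply: (eb n m); rewrite !lattice_point_slope in hx hy *; lra.
Qed.

Lemma empty_box_transpose x1 x2 y1 y2 l r p q :
  empty_box (mx22 x1 x2 y1 (- y2) : 'M[R]_2) l r p q ->
  empty_box (mx22 y1 y2 x1 (- x2)) p q l r.
Proof.
move=> eb m n hx hy; apply: (eb m (- n)); rewrite !lattice_point_slope in hx hy *;
  rewrite mulrNz mulrN; lra.
Qed.

Lemma empty_box_add x1 x2 y1 y2 l r p q :
  empty_box (mx22 x1 x2 y1 (- y2) : 'M[R]_2) l r p q ->
  empty_box (mx22 x1 (x1 + x2) y1 (- (y2 - y1))) l r p q.
Proof.
move=> eb m n hx hy; apply: (eb (m + n) n); rewrite !lattice_point_slope in hx hy *;
  rewrite intrD; lra.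
Qed.

(** [x1 + x2] is the width of the box of the given basis, and the maximum of
    [y1] and [y2] is the height of the box of the next basis: an empty box
    cannot exceed both. *)
Lemma gap x1 x2 y1 y2 l r p q : 0 < x1 -> 0 < x2 -> 0 < y1 -> 0 < y2 ->
  empty_box (mx22 x1 x2 y1 (- y2)) l r p q ->
  r - l <= x1 + x2 \/ q - p <= Num.max y1 y2.
Proof.
move=> x10 x20 y10 y20 eb; have [y12|/ltW y21] := leP y1 y2; first exact: gap_le eb.
have := gap_le x20 x10 y20 y21 (empty_box_reflect eb).
by case=> h; [left|right]; lra.
Qed.

Section System.
Variables (S : R -> R -> Prop) (v : R).
Hypothesis sysS : slope_system S.
Hypothesis Sv : forall a b, S a b -> 1 + a * b <= v * (a + b).

(** The basis vectors are [(x1, y1)] and [(x2, - y2)]. *)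
Definition basis_slopes x1 x2 y1 y2 :=
  [/\ 0 < x1, 0 < x2, 0 < y1, 0 < y2 & S (x2 / x1) (y2 / y1)].

Lemma basis_slopes_area x1 x2 y1 y2 : basis_slopes x1 x2 y1 y2 ->
  (x1 + x2) * (y1 + y2) <= (1 + v) * (x1 * y2 + x2 * y1).
Proof.
case=> x10 x20 y10 y20 /Sv.
have xy0 : 0 < x1 * y1 by rewrite mulr_gt0.
rewrite -(ler_pM2r xy0).
rewrite (_ : _ * (x1 * y1) = x1 * y1 + x2 * y2); last by field; lra.
rewrite [X in _ <= X -> _](_ : _ = v * (x1 * y2 + x2 * y1)); last by field; lra.
by lra.
Qed.

Lemma basis_slopes_reflect x1 x2 y1 y2 :
  basis_slopes x1 x2 y1 y2 -> basis_slopes x2 x1 y2 y1.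
Proof.
by case=> x10 x20 y10 y20 /(slope_inv sysS); rewrite !invf_div => h; split.
Qed.

Lemma basis_slopes_transpose x1 x2 y1 y2 :
  basis_slopes x1 x2 y1 y2 -> basis_slopes y1 y2 x1 x2.
Proof. by case=> x10 x20 y10 y20 /(slope_sym sysS) h; split. Qed.

Lemma basis_slopes_add x1 x2 y1 y2 : y1 < y2 ->
  basis_slopes x1 x2 y1 y2 -> basis_slopes x1 (x1 + x2) y1 (y2 - y1).
Proof.
move=> y12 [x10 x20 y10 y20 /(slope_sym sysS) h].
have g1 : 1 < y2 / y1 by rewrite ltr_pdivlMr // mul1r.
have := slope_sym sysS (slope_sub sysS h g1).
split=> //; [by rewrite addr_gt0|by rewrite subr_gt0|].
by rewrite mulrDl mulrBl !divff ?gt_eqF // addrC.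
Qed.

Lemma basis_slopes_neq x1 x2 y1 y2 : basis_slopes x1 x2 y1 y2 -> y1 != y2.
Proof.
case=> _ _ y10 _ /(slope_sym sysS) /(slope_neq1 sysS); apply: contra_neq => <-.
by rewrite divff ?gt_eqF.
Qed.

(** Along the chain of bases the widths increase by at least [mu] at each
    step, and the box remains lower than the box of the current basis until it
    is also narrower. *)
Lemma empty_area_forward n x1 x2 y1 y2 l r p q mu : 0 < mu ->
  mu <= x1 -> mu <= x2 -> basis_slopes x1 x2 y1 y2 -> l < r -> p < q ->
  empty_box (mx22 x1 x2 y1 (- y2)) l r p q ->
  q - p <= y1 + y2 -> r - l <= x1 + x2 + n%:R * mu ->
  (r - l) * (q - p) <= (1 + v) * (x1 * y2 + x2 * y1).
Proof.
elim: n x1 x2 y1 y2 p q => [|n IH] x1 x2 y1 y2 p q mu0 mu1 mu2 bs lr pq eb hy hx.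
  apply: le_trans (basis_slopes_area bs).
  by rewrite mul0r addr0 in hx; apply: ler_pM; lra.
have [hx'|hy'] : r - l <= x1 + x2 \/ q - p <= Num.max y1 y2.
- by case: bs => x10 x20 y10 y20 _; exact: gap eb.
- apply: le_trans (basis_slopes_area bs).
  by apply: ler_pM; lra.
have key x1' x2' y1' y2' p' q' : y1' < y2' -> mu <= x1' -> mu <= x2' ->
    basis_slopes x1' x2' y1' y2' -> p' < q' ->
    empty_box (mx22 x1' x2' y1' (- y2')) l r p' q' ->
    q' - p' <= y2' -> r - l <= x1' + x2' + n.+1%:R * mu ->
    (r - l) * (q' - p') <= (1 + v) * (x1' * y2' + x2' * y1').
  move=> y12 m1 m2 bs' pq' eb' hy1 hx1.
  have := IH _ _ _ _ p' q' mu0 m1 _ (basis_slopes_add y12 bs') lr pq' (empty_box_add eb').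
  rewrite (_ : x1' * (y2' - y1') + (x1' + x2') * y1' = x1' * y2' + x2' * y1'); last by ring.
  by rewrite -natr1 in hx1; apply; lra.
have [y12|y21|e] := ltgtP y1 y2.
- by rewrite (max_r (ltW y12)) in hy'; apply: key.
- rewrite (max_l (ltW y21)) in hy'.
  have := key _ _ _ _ _ _ y21 mu2 mu1 (basis_slopes_reflect bs) _ (empty_box_reflect eb).
  rewrite opprK [- p + q]addrC [x2 * y1 + _]addrC [x2 + x1]addrC; apply => //; lra.
- by move/eqP: e; rewrite (negbTE (basis_slopes_neq bs)).
Qed.

Lemma empty_area_low x1 x2 y1 y2 l r p q :
  basis_slopes x1 x2 y1 y2 -> l < r -> p < q ->
  empty_box (mx22 x1 x2 y1 (- y2)) l r p q -> q - p <= y1 + y2 ->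
  (r - l) * (q - p) <= (1 + v) * (x1 * y2 + x2 * y1).
Proof.
move=> bs lr pq eb hy; have [x10 x20 y10 y20 _] := bs.
pose mu := Num.min x1 x2.
have mu0 : 0 < mu by rewrite lt_min x10.
apply: (empty_area_forward (n := (Num.truncn ((r - l) / mu)).+1) mu0) => //.
- by rewrite ge_min lexx.
- by rewrite ge_min lexx orbT.
have : (r - l) / mu < (Num.truncn ((r - l) / mu)).+1%:R by exact: truncnS_gt.
by rewrite ltr_pdivrMr //; lra.
Qed.

(** By [gap] a box is lower or narrower than the box of the given basis;
    exchanging the coordinates reduces the second case to the first one. *)
Lemma empty_area x1 x2 y1 y2 l r p q :
  basis_slopes x1 x2 y1 y2 -> l < r -> p < q ->
  empty_box (mx22 x1 x2 y1 (- y2)) l r p q ->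
  (r - l) * (q - p) <= (1 + v) * (x1 * y2 + x2 * y1).
Proof.
move=> bs lr pq eb; have [x10 x20 y10 y20 _] := bs.
have [hx|hy] := gap x10 x20 y10 y20 eb; last first.
  apply: empty_area_low => //; apply: le_trans hy _.
  by rewrite ge_max; lra.
rewrite mulrC [x1 * y2 + _]addrC [x2 * y1]mulrC [x1 * y2]mulrC.
by apply: empty_area_low (basis_slopes_transpose bs) _ _ (empty_box_transpose eb) hx.
Qed.

Lemma ndisp_slope_le a b : S a b ->
  (ndisp (lattice_of (slope_mx a b)) <= (1 + v)%:E)%E.
Proof.
move=> Sab; have [a0 b0] := slope_gt0 sysS Sab.
apply: ndisp_le; first exact: slope_mx_unit.
move=> l r p q lr pq eb; rewrite slope_mx_det // lee_fin ler_pdivrMr ?addr_gt0 //.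
have bs : basis_slopes 1 a 1 b by split; rewrite ?divr1.
by have := empty_area bs lr pq eb; rewrite mul1r mulr1 [b + a]addrC.
Qed.

End System.
End UpperBound.

(** * Dispersion of the extremal lattices *)

Section Chains.
Context {R : realType}.
Implicit Types (a b x y X Y s d : R).
Local Notation phi := (@golden R).

Section CutChain.
Variable C : R -> R -> Prop.
Hypothesis C_gt1 : forall X Y, C X Y -> 1 < X.
Hypothesis C_sym : forall X Y, C X Y -> C Y X.
Hypothesis C_step : forall X Y, C X Y ->
  (exists2 x, X = cf1 x & C x (cf1 Y)) \/ (exists2 x, X = cf2 x & C x (cf2 Y)).

(** All slopes that arise from a set [C] of cuts with digits 1 and 2.  Each
    basis is listed with both orders of its vectors. *)
Inductive chain_slopes : R -> R -> Prop :=
| chain_cut X Y : C X Y -> chain_slopes X Y^-1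
| chain_cut_inv X Y : C X Y -> chain_slopes X^-1 Y
| chain_mid x Y : C (cf2 x) Y -> C x (cf2 Y) -> chain_slopes (cf1 x) (cf1 Y)
| chain_mid_inv x Y : C (cf2 x) Y -> C x (cf2 Y) ->
    chain_slopes (cf1 x)^-1 (cf1 Y)^-1.

Lemma chain_slopes_system : slope_system chain_slopes.
Proof.
have C_gt1' X Y : C X Y -> 1 < Y by move=> /C_sym/C_gt1.
have cf1_gt1 x : 1 < x -> 1 < cf1 x by case/cf1_bounds/andP.
have inv_lt1 x : 1 < x -> x^-1 < 1 by move=> h; rewrite invf_lt1 //; lra.
split.
- move=> a b [X Y c|X Y c|x Y c' c|x Y c' c].
  + have := C_gt1 c; have := C_gt1' _ _ c; rewrite invr_gt0; lra.
  + have := C_gt1 c; have := C_gt1' _ _ c; rewrite invr_gt0; lra.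
  + have := cf1_gt1 _ (C_gt1 c); have := cf1_gt1 _ (C_gt1' _ _ c'); lra.
  + have := cf1_gt1 _ (C_gt1 c); have := cf1_gt1 _ (C_gt1' _ _ c').
    by rewrite !invr_gt0; lra.
- move=> a b [X Y c|X Y c|x Y c' c|x Y c' c].
  + by rewrite gt_eqF // (C_gt1 c).
  + by rewrite lt_eqF // inv_lt1 // (C_gt1 c).
  + by rewrite gt_eqF // cf1_gt1 // (C_gt1 c).
  + by rewrite lt_eqF // inv_lt1 // cf1_gt1 // (C_gt1 c).
- move=> a b [X Y c|X Y c|x Y c' c|x Y c' c].
  + exact/chain_cut_inv/C_sym.
  + exact/chain_cut/C_sym.
  + by apply: chain_mid; exact: C_sym.
  + by apply: chain_mid_inv; exact: C_sym.
- move=> a b [X Y c|X Y c|x Y c' c|x Y c' c]; rewrite ?invrK.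
  + exact: chain_cut_inv.
  + exact: chain_cut.
  + exact: chain_mid_inv.
  + exact: chain_mid.
- move=> a b [X Y c|X Y c|x Y c' c|x Y c' c] a1.
  + have [[x eX c']|[x eX c']] := C_step c.
      rewrite eX {1}/cf1 addrC addKr [_ + 1]addrC.
      exact: chain_cut_inv c'.
    have -> : X - 1 = cf1 x by rewrite eX /cf2 /cf1; lra.
    have -> : Y^-1 + 1 = cf1 Y by rewrite /cf1 addrC.
    by apply: chain_mid; rewrite -?eX.
  + by have := inv_lt1 _ (C_gt1 c); lra.
  + have -> : cf1 x - 1 = x^-1 by rewrite /cf1; lra.
    have -> : cf1 Y + 1 = cf2 Y by rewrite /cf2 /cf1; lra.
    exact: chain_cut_inv.
  + by have := inv_lt1 _ (cf1_gt1 _ (C_gt1 c)); lra.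
Qed.

(** Since [(1 + X * Y^-1) <= X + Y^-1] for [X, Y >= 1], a cut between two
    digits has value at most 1, and only the middles of digits 2 matter. *)
Lemma chain_slopes_le v : 1 <= v ->
  (forall x Y, C (cf2 x) Y -> C x (cf2 Y) ->
     1 + cf1 x * cf1 Y <= v * (cf1 x + cf1 Y)) ->
  forall a b, chain_slopes a b -> 1 + a * b <= v * (a + b).
Proof.
move=> v1 hv.
have cut_le X Y : C X Y -> 1 + X * Y^-1 <= v * (X + Y^-1).
  move=> c; have X1 := C_gt1 c; have Y1 := C_gt1 (C_sym c).
  have Y0 : 0 < Y^-1 < 1 by rewrite invr_gt0 invf_lt1; lra.
  move: Y^-1 Y0 => y Y0.
  have h : 1 + X * y <= X + y by nra.
  apply: le_trans h _; rewrite -[X in X <= _]mul1r; apply: ler_wpM2r; lra.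
have inv_le x y : 0 < x -> 0 < y -> 1 + x * y <= v * (x + y) ->
    1 + x^-1 * y^-1 <= v * (x^-1 + y^-1).
  move=> x0 y0 h; have xy0 : 0 < x * y by rewrite mulr_gt0.
  rewrite -(ler_pM2r xy0).
  rewrite [leLHS](_ : _ = 1 + x * y); last by field; lra.
  by rewrite [leRHS](_ : _ = v * (x + y)); last by field; lra.
have cf1_gt0 x : 1 < x -> 0 < cf1 x by move=> /cf1_bounds; lra.
move=> a b [X Y c|X Y c|x Y c' c|x Y c' c].
- exact: cut_le.
- by have := cut_le _ _ (C_sym c); rewrite mulrC [Y + _]addrC.
- exact: hv.
- apply: inv_le; [exact/cf1_gt0/(C_gt1 c)|exact/cf1_gt0/(C_gt1 (C_sym c'))|exact: hv].
Qed.

End CutChain.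

Lemma cf2_inj x y : cf2 x = cf2 y -> x = y.
Proof. by move=> /addrI /invr_inj. Qed.

Lemma slope_value_mid b s (d := quad_slope b) : cf2 s = d -> 2 < d ->
  (1 + cf1 s * cf1 d) / (cf1 s + cf1 d) = slope_value b - 1.
Proof.
move=> es d2; rewrite /slope_value -quad_slope_sum -/d.
have -> : cf1 s = d - 1 by rewrite -es /cf1 /cf2; lra.
clear es; have -> : b + 1 = d - d^-1 + 1 by rewrite /d quad_slope_inv; lra.
by move: d d2 => d d2; rewrite /cf1; field; nra.
Qed.

Section OnesChain.
Variables (b s : R) (K : R -> R -> Prop).
Let d := quad_slope b.
Hypothesis hb : 2 <= b < 9 / 4.
Hypothesis s_gt1 : 1 < s.
Hypothesis es : cf2 s = d.
Hypothesis K_gt1 : forall X Y, K X Y -> 1 < X.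
Hypothesis K_sym : forall X Y, K X Y -> K Y X.
Hypothesis K_start : K s (cf2 d).
Hypothesis K_step : forall X Y, K X Y ->
  (X = cf2 d /\ Y = s) \/ (exists2 x, X = cf1 x & K x (cf1 Y)).

(** [K] consists of the cuts in the runs of 1s around a block 2,2.  With the
    cut inside the block they form a complete chain, whose largest values are those
    at the middles of the two digits 2. *)
Lemma ndisp_ones_chain :
  ndisp (lattice_of (slope_mx d d^-1)) = (slope_value b)%:E.
Proof.
have hd : 2 < d < 3 by exact: quad_slope_bounds.
have b2 := hb; have s1 := s_gt1.
have d0 : 0 < d by lra.
have v1 : 1 <= slope_value b - 1.
  rewrite /slope_value [1 + _]addrC addrK ler_pdivlMr ?disc_gt0 // mul1r.
  have b1 : 0 <= b + 1 by lra.
  have b4 : 0 <= b ^+ 2 + 4 by rewrite expr2; nra.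
  rewrite -ler_sqr ?nnegrE ?sqrtr_ge0 // sqr_sqrtr // !expr2; nra.
pose C X Y := K X Y \/ X = d /\ Y = d.
have C_gt1 X Y : C X Y -> 1 < X by case=> [/K_gt1 //|[-> _]]; lra.
have C_sym X Y : C X Y -> C Y X by case=> [/K_sym|[-> ->]]; [left|right].
have C_step X Y : C X Y ->
    (exists2 x, X = cf1 x & C x (cf1 Y)) \/ (exists2 x, X = cf2 x & C x (cf2 Y)).
  case=> [/K_step[[-> ->]|[x -> Kx]]|[-> ->]].
  - by right; exists d; rewrite ?es //; right.
  - by left; exists x => //; left.
  - by right; exists s; rewrite ?es //; left.
have s0 := K_gt1 K_start.
have sd0 : 0 < cf1 s + cf1 d.
  by have := cf1_bounds s_gt1; have := @cf1_bounds R d; lra.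
have mid : 1 + cf1 s * cf1 d <= (slope_value b - 1) * (cf1 s + cf1 d).
  by rewrite -ler_pdivrMr // (slope_value_mid es) // (andP hd).1.
apply/eqP; rewrite eq_le; apply/andP; split.
  rewrite (_ : slope_value b = 1 + (slope_value b - 1)); last by lra.
  apply: (ndisp_slope_le (chain_slopes_system C_gt1 C_sym C_step)); last first.
    by apply: chain_cut; right.
  apply: chain_slopes_le => // x Y; case=> [KxY|[xd ->]] c.
    have x1 := C_gt1 _ _ c.
    case: (K_step KxY) => [[/cf2_inj -> ->]|[z ez /K_gt1 z1]].
      by rewrite mulrC [cf1 d + _]addrC.
    by have := cf2_bounds x1; have := cf1_bounds z1; rewrite ez; lra.
  by move: xd; rewrite -es => /cf2_inj ->; rewrite es.
have shift : nba_mx (slope_mx d d^-1) (slope_mx (cf1 s) (cf1 d)).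
  have := nba_slope_shift d d^-1 1; rewrite (_ : d - 1 = cf1 s); last first.
    by rewrite -es /cf1 /cf2; lra.
  by rewrite [_ + 1]addrC.
rewrite (ndisp_nba _ shift) ?slope_mx_unit ?invr_gt0 //.
have := @ndisp_slope_ge R (cf1 s) (cf1 d).
rewrite (slope_value_mid es) ?(andP hd).1 //.
rewrite [1 + _]addrC subrK; apply.
  by have := cf1_bounds s_gt1; lra.
by have := @cf1_bounds R d; lra.
Qed.

End OnesChain.

Lemma ndisp_golden :
  ndisp (lattice_of (slope_mx phi phi^-1)) = (slope_value 1)%:E.
Proof.
have gl := @golden_lb R; have gu := @golden_ub R; have phi0 : 0 < phi by lra.
have e1 : phi^-1 = phi - 1 by exact: golden_inv.
have i0 : 0 < phi^-1 by rewrite invr_gt0.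
have ev : slope_value 1 = 1 + (1 + phi * phi^-1) / (phi + phi^-1).
  rewrite /slope_value -quad_slope_sum quad_slope_golden divff //.
  by apply/eqP; lra.
have [p0 p1] : phi + phi^-1 != 0 /\ phi != 0 by split; apply/eqP; lra.
apply/eqP; rewrite eq_le ev ndisp_slope_ge // andbT.
pose S (a b : R) := (a = phi /\ b = phi^-1) \/ (a = phi^-1 /\ b = phi).
apply: (@ndisp_slope_le R S); last by left.
  split.
  - by move=> a b [[-> ->]|[-> ->]].
  - by move=> a b [[-> _]|[-> _]]; apply/eqP; lra.
  - by move=> a b [[-> ->]|[-> ->]]; [right|left].
  - by move=> a b [[-> ->]|[-> ->]]; rewrite invrK; [right|left].
  - move=> a b [[-> ->]|[-> ->]] a1; last by lra.
    by right; rewrite -e1; split=> //; lra.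
by move=> a b [[-> ->]|[-> ->]]; rewrite 1?[phi^-1 * _]mulrC 1?[phi^-1 + _]addrC divfK.
Qed.

(** The cuts in the run of 1s leave [j] of its digits on one side and [k] on
    the other one. *)
Lemma ndisp_periodic n :
  ndisp (lattice_of (slope_mx (periodic_slope n) (periodic_slope n)^-1)) =
  (slope_value (slope_trace n : R))%:E.
Proof.
set d := periodic_slope n; have hd := @periodic_slope_bounds R n.
have z1 : 1 < cf2 d by have := @cf2_bounds R d; rewrite -/d in hd; lra.
pose p j := iter j cf1 (cf2 d).
pose K X Y := exists j k, [/\ (j + k = n.*2)%N, X = p j & Y = p k].
have es : p n.*2 = periodic_tail n by rewrite /p iter_cf1_double // periodic_tailE.
apply: (@ndisp_ones_chain _ (periodic_tail n) K).
- exact: slope_trace_bounds.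
- exact: periodic_tail_gt1.
- exact: cf2_periodic_tail.
- by move=> X Y [j [k [_ -> _]]]; exact: iter_cf1_gt1.
- by move=> X Y [j [k [jk -> ->]]]; exists k, j; rewrite addnC.
- by exists n.*2, 0%N; rewrite addn0.
- move=> X Y [[|j] [k [jk -> ->]]].
    by left; rewrite -es -jk.
  by right; exists (p j) => //; exists j, k.+1; rewrite addnS -addSn.
Qed.

(** Here the only block 2,2 is followed and preceded by infinitely many 1s. *)
Lemma ndisp_limit :
  ndisp (lattice_of (slope_mx (phi ^+ 2) (phi ^+ 2)^-1)) =
  (slope_value (Num.sqrt 5))%:E.
Proof.
rewrite -quad_slope_sqrt5; set d := quad_slope _.
have gl := @golden_lb R; have phi1 : 1 < phi by lra.
have e1 : phi^-1 = phi - 1 by exact: golden_inv.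
have ed : cf2 phi = d.
  by rewrite /d quad_slope_sqrt5 expr2 golden_sqr /cf2 e1; lra.
have hd : 2 < d < 3 by rewrite -ed; exact: cf2_bounds.
have z1 : 1 < cf2 d by have := @cf2_bounds R d; lra.
pose p j := iter j cf1 (cf2 d).
pose K X Y := (exists j, X = p j /\ Y = phi) \/ (exists j, X = phi /\ Y = p j).
have e2 : cf1 phi = phi by rewrite /cf1 e1; lra.
apply: (@ndisp_ones_chain _ phi K) => //.
- by have := @sqrt5_lt R; rewrite sqrt5E; lra.
- by move=> X Y [] [j [-> _]] //; exact: iter_cf1_gt1.
- by move=> X Y [] [j [-> ->]]; [right|left]; exists j.
- by right; exists 0%N.
- move=> X Y [[[|j] [-> ->]]|[j [-> ->]]]; first by left.
    by right; exists (p j) => //; left; exists j.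
  by right; exists phi; rewrite ?e2 //; right; exists j.+1.
Qed.

End Chains.

(** * Continued fractions and conjugates *)

Section ContinuedFractions.
Context {R : realType}.
Implicit Types (a : nat -> nat) (x : nat -> R).
Local Notation phi := (@golden R).

Lemma convergent_ge1 a n : (forall k, (0 < a k)%N) -> 1 <= convergent a n :> R.
Proof.
elim: n a => [|n IH] a a1 /=; first by rewrite ler1n.
have : 0 <= (convergent (fun k => a k.+1) n)^-1 :> R.
  by rewrite invr_ge0; apply: le_trans (IH _ _) => // k; exact: a1.
by have : 1 <= (a 0%N)%:R :> R; [rewrite ler1n | lra].
Qed.

(** Inverting two numbers divides their distance by their product, which is
    here at least 5/4. *)
Lemma convergent_dist a x n : (forall k, (0 < a k.+1)%N) ->
  (forall k, x k = (a k)%:R + (x k.+1)^-1) -> (forall k, 5 / 4 <= x k.+1) ->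
  `|convergent a n - x 0%N| <= (4 / 5) ^+ n.
Proof.
elim: n a x => [|n IH] a x a1 xE x1 /=.
  rewrite xE opprD addrA subrr add0r normrN expr0 ger0_norm ?invr_ge0.
    by rewrite invf_le1; have := x1 0%N; lra.
  by have := x1 0%N; lra.
have := IH (fun k => a k.+1) (fun k => x k.+1) (fun k => a1 k.+1)
  (fun k => xE k.+1) (fun k => x1 k.+1).
have := @convergent_ge1 (fun k => a k.+1) n a1.
rewrite (xE 0%N) opprD addrACA subrr add0r exprS /=.
move: (convergent _ _) (x 1%N) (x1 0%N) => c y y1 c1 le.
have -> : c^-1 - y^-1 = - ((c * y)^-1 * (c - y)) by field; lra.
rewrite normrN normrM ger0_norm ?invr_ge0; last by nra.
apply: ler_pM => //; first by rewrite invr_ge0; nra.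
by rewrite -[4 / 5]invf_div lef_pV2 ?posrE; nra.
Qed.

Lemma convergent_cvg a x : (forall k, (0 < a k.+1)%N) ->
  (forall k, x k = (a k)%:R + (x k.+1)^-1) -> (forall k, 5 / 4 <= x k.+1) ->
  convergent a n @[n --> \oo] --> x 0%N.
Proof.
move=> a1 xE x1.
have g : geometric 1 (4 / 5) n @[n --> \oo] --> (0 : R).
  by apply: cvg_geometric; rewrite ger0_norm; lra.
apply: (@squeeze_cvgr _ _ _ _ (fun n => x 0%N - geometric 1 (4 / 5) n)
  (fun n => x 0%N + geometric 1 (4 / 5) n)).
- near=> n; have := convergent_dist n a1 xE x1.
  by rewrite /geometric /= mul1r ler_norml; lra.
- by rewrite -[X in _ --> X]subr0; apply: cvgB => //; exact: cvg_cst.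
- by rewrite -[X in _ --> X]addr0; apply: cvgD => //; exact: cvg_cst.
Unshelve. all: by end_near.
Qed.

Lemma cfrac_eq (u w : seq nat) x
    (a := fun k => if (k < size u)%N then nth 0%N u k
                   else nth 0%N w ((k - size u) %% size w)) :
  (forall k, (0 < a k.+1)%N) ->
  (forall k, x k = (a k)%:R + (x k.+1)^-1) -> (forall k, 5 / 4 <= x k.+1) ->
  cfrac u w = x 0%N.
Proof.
move=> a1 xE x1; rewrite /cfrac -/a; apply: cvg_lim => //.
exact: convergent_cvg.
Qed.

Lemma cfrac_sqr_golden : cfrac [:: 2%N] [:: 1%N] = phi ^+ 2.
Proof.
have g := @golden_lb R; have gi := @golden_inv R; have g2 := @golden_sqr R.
apply: (@cfrac_eq _ _ (fun k => if k is 0%N then phi ^+ 2 else phi)).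
- by move=> k /=; rewrite modn1.
- by case=> [|k] /=; rewrite ?modn1 /= gi ?expr2; lra.
- by move=> k; lra.
Qed.

Lemma cfrac_inv_sqr_golden : cfrac [:: 0%N; 2%N] [:: 1%N] = phi ^- 2.
Proof.
have g := @golden_lb R; have gi := @golden_inv R; have g2 := @golden_sqr R.
apply: (@cfrac_eq _ _ (fun k => if k is k'.+1 then
    if k' is 0%N then phi ^+ 2 else phi else phi ^- 2)).
- by case=> [|k] //=; rewrite modn1.
- by case=> [|[|k]] /=; rewrite ?modn1 /= ?add0r // gi ?expr2; lra.
- by case=> [|k]; rewrite ?expr2; lra.
Qed.

Lemma cfrac_periodic n :
  cfrac [::] (2%N :: nseq (2 * n) 1%N ++ [:: 2%N]) = periodic_slope n :> R.
Proof.
set d := periodic_slope n; have hd := @periodic_slope_bounds R n; rewrite -/d in hd.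
have z1 : 2 < cf2 d < 3 by apply: cf2_bounds; lra.
pose p j := iter j cf1 (cf2 d).
have p_bounds j : 5 / 4 <= p j < 3.
  elim: j => [|j IH]; first by rewrite /p /=; lra.
  have hj : 1 < p j < 3 by lra.
  have := invf_bounds ltr01 hj; rewrite divr1.
  by rewrite /p iterS -/(p j) /cf1; lra.
(* [X r] is the tail of the expansion from position [r] of the period on. *)
pose X r := if r is r'.+1 then p (2 * n - r')%N else d.
have X_bound r : 5 / 4 <= X r.
  by case: r => [|r] /=; [lra | case/andP: (p_bounds (2 * n - r)%N)].
have pn : p (2 * n)%N = periodic_tail n.
  by rewrite mul2n /p iter_cf1_double ?periodic_tailE //; lra.
apply: (@cfrac_eq _ _ (fun k => X (k %% (2 * n).+2)%N)).
- move=> k /=; rewrite subn0 size_cat size_nseq addn1.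
  have : (k.+1 %% (2 * n).+2 < (2 * n).+2)%N by rewrite ltn_mod.
  case: (_ %% _)%N => [|r] //= hr; rewrite nth_cat size_nseq.
  have [h|h] := ltnP r (2 * n); first by rewrite nth_nseq h.
  by rewrite (_ : r - 2 * n = 0)%N //; lia.
- move=> k /=; rewrite subn0 size_cat size_nseq addn1.
  have hk : (k %% (2 * n).+2 < (2 * n).+2)%N by rewrite ltn_mod.
  have -> : (k.+1 %% (2 * n).+2 = (k %% (2 * n).+2).+1 %% (2 * n).+2)%N.
    by rewrite -[in RHS]addn1 modnDml addn1.
  case: (k %% _)%N hk => [|r] hr /=.
    rewrite ?modn_small //= ?subn0 pn; exact/esym/cf2_periodic_tail.
  rewrite nth_cat size_nseq; have [h|h] := ltnP r (2 * n).
    rewrite modn_small ?nth_nseq ?h //= -[in LHS](subnSK h) //.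
  have er : r = (2 * n)%N by lia.
  by rewrite er subnn modnn.
- by move=> k; exact: X_bound.
Qed.

End ContinuedFractions.

Section Conjugates.
Context {R : realType}.

(** A square is 0 or 1 modulo 3, so 3 would divide both the numerator and the
    denominator. *)
Lemma rat_sqr_mod3 (y : rat) (D : nat) : (D %% 3 = 2)%N -> y ^+ 2 != D%:R.
Proof.
move=> D3; apply/eqP => e.
have : (`|numq y| ^ 2 = D * `|denq y| ^ 2)%N.
  have h : ((numq y) ^+ 2)%:~R = (D%:Z * denq y ^+ 2)%:~R :> rat.
    by rewrite rmorphXn /= numqE exprMn e rmorphM rmorphXn.
  by have := congr1 absz (intr_inj h); rewrite abszM !abszX.
have := coprime_num_den y.
move: `|numq y|%N `|denq y|%N => m q cop emq.
have sq3 k : (k ^ 2 %% 3 = (k %% 3 != 0))%N.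
  rewrite -modnXm; have : (k %% 3 < 3)%N by rewrite ltn_mod.
  by case: (k %% 3)%N => [|[|[|]]].
have := sq3 m; rewrite emq -modnMm D3 sq3.
have [q3|q3] := eqVneq (q %% 3)%N 0%N; last by case: (_ != _).
have [m3 _|//] := eqVneq (m %% 3)%N 0%N.
have : (3 %| gcdn m q)%N by rewrite dvdn_gcd /dvdn m3 q3.
by rewrite (eqP cop).
Qed.

(** The discriminant of the quadratic polynomial is a square times a
    natural number that is 2 modulo 3. *)
Lemma periodic_conjugate n :
  quadratic_conjugate (periodic_slope n : R) (- (periodic_slope n)^-1).
Proof.
pose t : rat := let: (f, g) := fib_pair n in (4 * f%:R + 3 * g%:R) / (2 * f%:R + g%:R).
have tE : ratr t = slope_trace n :> R.
  rewrite /t /slope_trace; case: (fib_pair n) => f g.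
  by rewrite fmorph_div !rmorphD !rmorphM !rmorph_nat.
pose q : {poly rat} := t%:P * 'X + 1%:P.
have sq : (size q <= 2)%N.
  by rewrite size_MXaddC; case: ifP => // _; rewrite ltnS size_polyC_leq1.
have sp : size ('X^2 - q) = 3%N.
  by rewrite size_polyDl ?size_polyXn // size_polyN ltnS.
exists ('X^2 - q); split => //.
- apply: cubic_irreducible; first by rewrite sp.
  move=> r; apply/negP; rewrite rootE /q !hornerE /= => /eqP e.
  have := fib_pair_det n; have := fib_pair_ltn n; move: e; rewrite /t.
  case: (fib_pair n) => f g /= e gf det.
  (* [D] is [(4 * f + 3 * g) ^ 2 + 4 * (2 * f + g) ^ 2], rewritten with the
     determinant identity. *)
  pose D := (3 * (10 + 24 * (f * g) + 15 * (g * g)) + 2)%N.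
  have /negP := @rat_sqr_mod3 ((2 * f%:R + g%:R) * 2 * r - (4 * f%:R + 3 * g%:R)) D
    (ltac:(by rewrite /D mulnC modnMDl)).
  apply; apply/eqP.
  have f0 : 0 < f%:R :> rat by rewrite ltr0n; lia.
  have g0 : 0 <= g%:R :> rat by [].
  have {}det : f%:R * f%:R = 1 + f%:R * g%:R + g%:R * g%:R :> rat.
    by rewrite -!natrM det !natrD.
  rewrite /D !(natrD, natrM).
  move: f%:R g%:R e f0 g0 det => {D gf}F G e f0 g0 det.
  have M0 : 2 * F + G != 0 by rewrite gt_eqF // ltr_wpDr // mulr_gt0.
  have e2 : (2 * F + G) * r ^+ 2 = (4 * F + 3 * G) * r + (2 * F + G).
    have -> : r ^+ 2 = (4 * F + 3 * G) / (2 * F + G) * r + 1.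
      by apply/eqP; rewrite -subr_eq0; apply/eqP.
    by field.
  rewrite (_ : _ ^+ 2 = 4 * (2 * F + G) * ((2 * F + G) * r ^+ 2 - (4 * F + 3 * G) * r)
    + (4 * F + 3 * G) * (4 * F + 3 * G)); last by ring.
  rewrite e2; transitivity (32 * (F * F) + 40 * (F * G) + 13 * (G * G)); first by ring.
  by rewrite det; ring.
- have -> : lead_coef ('X^2 - q) = 1.
    by rewrite lead_coefDl ?lead_coefXn // size_polyXn size_polyN ltnS.
  rewrite rmorph1 scale1r /q rmorphB /= map_polyXn rmorphD /= rmorphM /=.
  rewrite !map_polyC map_polyX /= tE rmorph1.
  have -> : slope_trace n = periodic_slope n - (periodic_slope n)^-1 :> R.
    by rewrite /periodic_slope quad_slope_inv; lra.
  have d0 : periodic_slope n != 0 :> R by rewrite gt_eqF // quad_slope_gt0.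
  have e : (periodic_slope n)%:P * ((periodic_slope n)^-1)%:P = 1 :> {poly R}.
    by rewrite -polyCM divff.
  rewrite !rmorphB !rmorphN /=; move: (_%:P) (_%:P) e => u v e.
  by rewrite polyC1 -e; ring.
Qed.

End Conjugates.

(** * The smallest normalized dispersions *)

Section Ranking.
Context {R : realType}.
Local Notation phi := (@golden R).

(** The traces of all extremal lattices in increasing order of dispersion;
    the first one belongs to [golden]. *)
Definition trace_seq k : R := if k is n.+1 then slope_trace n else 1.

Definition trace_slope k : R := quad_slope (trace_seq k).

Definition trace_mx k : 'M[R]_2 := slope_mx (trace_slope k) (trace_slope k)^-1.

Lemma trace_slope_gt0 k : 0 < trace_slope k.
Proof. exact: quad_slope_gt0. Qed.

Lemma trace_mx_unit k : trace_mx k \in unitmx.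
Proof. by apply: slope_mx_unit; rewrite ?invr_gt0 trace_slope_gt0. Qed.

Lemma ndisp_trace_mx k : ndisp (lattice_of (trace_mx k)) = (slope_value (trace_seq k))%:E.
Proof.
case: k => [|n]; last exact: ndisp_periodic.
by rewrite /trace_mx /trace_slope /= quad_slope_golden ndisp_golden.
Qed.

Lemma trace_seq_lt i j : (i < j)%N -> trace_seq i < trace_seq j.
Proof.
case: j => // j; case: i => [_|i]; last by rewrite ltnS; exact: slope_trace_lt.
by rewrite /=; have := @slope_trace_ge2 R j; lra.
Qed.

Lemma trace_seq_bounds k : 0 <= trace_seq k /\ trace_seq k < Num.sqrt 5.
Proof.
have h5 := @slope_trace_sqrt5 R; have h2 := @slope_trace_ge2 R.
by case: k => [|n] /=; [have := h5 0%N; have := h2 0%N|have := h5 n; have := h2 n]; lra.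
Qed.

Lemma value_lt i j : (i < j)%N -> slope_value (trace_seq i) < slope_value (trace_seq j).
Proof.
move=> ij; have [b0 _] := trace_seq_bounds i; have [_ c5] := trace_seq_bounds j.
have h5 := @sqrt5_lt R; apply: slope_value_lt => //; [exact: trace_seq_lt|lra].
Qed.

Lemma value_lt_limit k : slope_value (trace_seq k) < slope_value (Num.sqrt 5).
Proof.
have [b0 b5] := trace_seq_bounds k.
by have h5 := @sqrt5_lt R; apply: slope_value_lt => //; lra.
Qed.

Lemma value_inj i j : slope_value (trace_seq i) = slope_value (trace_seq j) -> i = j.
Proof.
by move=> e; have [/value_lt|/value_lt|//] := ltngtP i j; rewrite e ltxx.
Qed.

Lemma slope_value_sqrt5 : slope_value (Num.sqrt 5) = (4 + Num.sqrt 5) / 3 :> R.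
Proof.
have -> : slope_value (Num.sqrt 5) = 1 + (Num.sqrt 5 + 1) / 3 :> R; last by field.
rewrite /slope_value sqr_sqrtr // (_ : 5 + 4 = 3 ^+ 2); last by ring.
by rewrite sqrtr_sqr ger0_norm.
Qed.

Lemma nba_below_limit (A : 'M[R]_2) : A \in unitmx ->
  (ndisp (lattice_of A) < (slope_value (Num.sqrt 5))%:E)%E ->
  exists k, nba_mx (trace_mx k) A.
Proof.
move=> uA lim; have fin : ndisp (lattice_of A) != +oo%E.
  by rewrite lt_eqF // (lt_trans lim) ?ltry.
have sys := lattice_slopes_system fin.
have small a b : lattice_slopes A a b -> 3 * (1 + a * b) < 2 * phi * (a + b).
  move=> sab; have [a0 b0 _] := sab.
  have := ndisp_slope_ge a0 b0; rewrite -(lattice_slopes_ndisp sab).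
  move=> /le_lt_trans /(_ lim); rewrite lte_fin slope_value_sqrt5 sqrt5E => h.
  have : (1 + a * b) / (a + b) < 2 * phi / 3 by lra.
  by rewrite ltr_pdivrMr ?addr_gt0 //; lra.
have ex : exists a b, lattice_slopes A a b.
  have [oo|[a [b [a0 b0 h]]]] := slope_or_infiniteP uA.
    by rewrite oo eqxx in fin.
  by exists a, b.
have [[_ _ h]|[n [_ _ h]]] :=
  slope_classification sys small periodic_tail_gt1
    (fun n => etrans (congr1 _ (congr1 _ (cf2_periodic_tail n))) (periodic_tailE n)) ex.
  by exists 0%N; rewrite /trace_mx /trace_slope /= quad_slope_golden.
by exists n.+1; move: h; rewrite cf2_periodic_tail.
Qed.

Lemma ndisp_values_trace k : ndisp_values (slope_value (trace_seq k))%:E.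
Proof.
exists (lattice_of (trace_mx k)); last exact: ndisp_trace_mx.
by exists (trace_mx k) => //; exact: trace_mx_unit.
Qed.

Lemma kth_value k : kth_smallest ndisp_values k.+1 (slope_value (trace_seq k))%:E.
Proof.
split; first exact: ndisp_values_trace.
have -> : [set y | ndisp_values y /\ (y <= (slope_value (trace_seq k))%:E)%E] =
    (fun i => (slope_value (trace_seq i))%:E) @` `I_k.+1.
  apply/seteqP; split=> y.
    move=> [[L [A uA ->] <-] le].
  have lim : ((slope_value (trace_seq k))%:E < (slope_value (Num.sqrt 5))%:E)%E.
    by rewrite lte_fin value_lt_limit.
  have [j h] := nba_below_limit uA (le_lt_trans le lim).
  have e := ndisp_nba (trace_mx_unit j) h; rewrite ndisp_trace_mx in e.
  exists j => //=; rewrite ltnS leqNgt; apply/negP => /value_lt.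
  by move: le; rewrite -e lee_fin; case: ltP.
  move=> [i /= ik <-]; split; first exact: ndisp_values_trace.
  rewrite lee_fin; move: ik; rewrite ltnS leq_eqVlt => /predU1P[->//|/value_lt/ltW//].
apply: inj_card_eq => i j _ _ [] /value_inj; exact.
Qed.

Lemma kth_lattice_trace k : kth_lattice k.+1 (lattice_of (trace_mx k)).
Proof.
split; first by exists (trace_mx k) => //; exact: trace_mx_unit.
  by rewrite ndisp_trace_mx; exact: kth_value.
move=> L [A uA ->]; split=> [e|].
  have [j h] : exists j, nba_mx (trace_mx j) A.
    by apply: nba_below_limit; rewrite // e ndisp_trace_mx lte_fin value_lt_limit.
  have ej : j = k.
    apply: value_inj; apply: EFin_inj; rewrite -!ndisp_trace_mx -e.
    by rewrite (ndisp_nba (trace_mx_unit j) h).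
  by rewrite ej in h; exists (trace_mx k), A; split => //; exact: trace_mx_unit.
by move=> [B [C [uB uC -> -> /(ndisp_nba uB)]]].
Qed.

(** The values differ from their limit by at most [(sqrt 5 - b) / 3], since
    the square root in [slope_value b] is at most 3. *)
Lemma value_cvg : (slope_value (trace_seq n.-1))%:E @[n --> \oo] -->
  (slope_value (Num.sqrt 5 : R))%:E.
Proof.
(* The ranks start at 1, and the first trace is not a [slope_trace]. *)
rewrite -(cvg_shiftn 2); apply: cvg_EFin; first by near=> n.
apply: (@squeeze_cvgr _ _ _ _ (fun n => slope_value (Num.sqrt 5) - 2 * harmonic n)
  (fun=> slope_value (Num.sqrt 5))); last 2 first.
- rewrite -[X in _ --> X]subr0 -(mulr0 2).
  by apply: cvgB; [exact: cvg_cst|apply: cvgMr; exact: cvg_harmonic].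
- exact: cvg_cst.
near=> n; rewrite /= addn2 /=; apply/andP; split; last exact/ltW/(value_lt_limit n.+1).
have := @slope_trace_sqrt5 R n; have := @slope_trace_ge2 R n.
have h5 : Num.sqrt 5 * Num.sqrt 5 = 5 :> R by rewrite -expr2 sqr_sqrtr.
rewrite slope_value_sqrt5 /slope_value /harmonic /=.
move: (slope_trace n) (n.+1%:R) (ltr0Sn R n) => b m m0 b2 hb.
have S0 := disc_gt0 b; have eS := sqr_disc b.
have i0 : 0 < m^-1 by rewrite invr_gt0.
have [bl bu] : b < Num.sqrt 5 /\ Num.sqrt 5 - b <= 4 * m^-1 by lra.
move: (Num.sqrt 5) h5 bl bu {hb} => r h5 bl bu.
move: (Num.sqrt _) S0 eS => S S0 eS.
have S3 : S <= 3 by nra.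
have : (b + 1) / 3 <= (b + 1) / S.
  by apply: ler_wpM2l; [lra|rewrite lef_pV2 ?posrE].
lra.
Unshelve. all: by end_near.
Qed.

Lemma lattice_of_col_opp a b :
  lattice_of (mx22 1 (- a) 1 b) = lattice_of (slope_mx a b : 'M[R]_2).
Proof.
have u : (mx22 1 0 0 (-1) : 'M[int]_2) \in unitmx by apply: mx22_unitmx.
rewrite -[RHS](lattice_of_unimodular _ u) map_mx22 mul_mx22.
by rewrite !mulr0 !mulr1 !addr0 !add0r mulrN1z !mulrN1 opprK.
Qed.

End Ranking.

Theorem theorem5p1 (R : realType) :
  let phi : R := golden in
  let Lambda5 := lattice_of (mx22 1 phi 1 (1 - phi)) in
  let Lambda2 := lattice_of (mx22 1 (1 + Num.sqrt 2) 1 (1 - Num.sqrt 2 : R)) in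
  [/\ kth_lattice 1 Lambda5 /\
        ndisp Lambda5 = (phi ^+ 3 / Num.sqrt 5)%:E,
      kth_lattice 2 Lambda2 /\
        ndisp Lambda2 = ((3 + 2 * Num.sqrt 2) / (2 * Num.sqrt 2))%:E,
      forall n : nat, (1 <= n)%N ->
        let Delta : R := cfrac [::] (2%N :: nseq (2 * n) 1%N ++ [:: 2%N]) in
        exists Delta' : R, quadratic_conjugate Delta Delta' /\
          kth_lattice (n + 2) (lattice_of (mx22 1 (- Delta) 1 (- Delta')))
    & let limit : \bar R := ((4 + Num.sqrt 5) / 3)%:E in
      (exists u : nat -> \bar R,
         (forall n : nat, (1 <= n)%N -> kth_smallest ndisp_values n (u n)) /\
         u n @[n --> \oo] --> limit) /\
      let Delta : R := cfrac [:: 2%N] [:: 1%N] in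
      let Delta' : R := - cfrac [:: 0%N; 2%N] [:: 1%N] in
      [/\ Delta = phi ^+ 2, - Delta' = phi ^- 2 &
          ndisp (lattice_of (mx22 1 (- Delta) 1 (- Delta'))) = limit]].
Proof.
move=> phi Lambda5 Lambda2.
have gi : phi^-1 = phi - 1 by exact: golden_inv.
have gg : phi * phi = phi + 1 by exact: golden_sqr.
have s5 : Num.sqrt 5 = 2 * phi - 1 :> R by exact: sqrt5E.
have gl : 55 / 34 < phi by exact: golden_lb.
have e5 : Lambda5 = lattice_of (trace_mx 0).
  rewrite /trace_mx /trace_slope /= quad_slope_golden -/phi /Lambda5 /slope_mx gi.
  by rewrite opprB.
have t0 : slope_trace 0 = 2 :> R by rewrite /slope_trace /=; field.
have s2 : Num.sqrt 2 * Num.sqrt 2 = 2 :> R by rewrite -expr2 sqr_sqrtr.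
have p2 : 0 < Num.sqrt 2 :> R by rewrite sqrtr_gt0.
have q2 : quad_slope 2 = 1 + Num.sqrt 2 :> R by apply: quad_slope_unique; lra.
have e2 : Lambda2 = lattice_of (trace_mx 1).
  rewrite /trace_mx /trace_slope /= t0 /slope_mx quad_slope_inv q2 /Lambda2.
  by congr (lattice_of (mx22 _ _ _ _)); lra.
split.
- rewrite e5; split; first exact: kth_lattice_trace.
  rewrite ndisp_trace_mx /= /slope_value -quad_slope_sum quad_slope_golden -/phi.
  by congr (_%:E); rewrite gi s5 exprS expr2 gg mulrDr gg; field; lra.
- rewrite e2; split; first exact: kth_lattice_trace.
  rewrite ndisp_trace_mx /= t0 /slope_value -quad_slope_sum quad_slope_inv q2.
  by congr (_%:E); field; lra.
- move=> n n1 Delta; exists (- Delta^-1).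
  rewrite {}/Delta cfrac_periodic opprK; split; first exact: periodic_conjugate.
  rewrite lattice_of_col_opp addn2.
  exact: (kth_lattice_trace n.+1).
- move=> limit; split.
    exists (fun n => (slope_value (trace_seq n.-1))%:E); split.
      by case=> // n _; exact: kth_value.
    by rewrite /limit -slope_value_sqrt5; exact: value_cvg.
  move=> Delta Delta'.
  rewrite /Delta' opprK cfrac_inv_sqr_golden /Delta cfrac_sqr_golden -/phi; split => //.
  by rewrite lattice_of_col_opp ndisp_limit slope_value_sqrt5.
Qed.
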